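(* Let $t\in\mathbb{R}$ and let $S_t^{(+)}=S^{(+)}_{N,p,q,r;t}=(\mathbb{H}\times\mathbb{C})/G^{(+)}_{N,p,q,r;t}$ be the Inoue surface with invariant $(1,0)$-forms $\theta^1=\frac{dw}{w_2}$, $\theta^2=\frac{z_2}{w_2}dw-dz$, and let $\eta=\frac{dw_2}{w_2}$ and $d_\eta=d-\eta\wedge$. Consider the cohomology at the middle term $(\wedge^{2,1}\oplus\wedge^{1,2})_{\mathbb{R}}$ of the complex of real forms on $S_t^{(+)}$ $$\wedge^{1,1}_{\mathbb{R}}\xrightarrow{\,d_\eta\,}(\wedge^{2,1}\oplus\wedge^{1,2})_{\mathbb{R}}\xrightarrow{\,d_\eta\,}(\wedge^{3,1}\oplus\wedge^{2,2}\oplus\wedge^{1,3})_{\mathbb{R}}\xrightarrow{\,d_\eta\,}\cdots .$$ The class $[\,i\,\theta^1\wedge\overline{\theta^1}\wedge dz_1]$ vanishes, that is, $i\,\theta^1\wedge\overline{\theta^1}\wedge dz_1=d_\eta\alpha$ for some $\alpha\in\wedge^{1,1}_{\mathbb{R}}$. However, the class $[\,i\,\theta^1\wedge\overline{\theta^1}\wedge dz_2]$ does not vanish.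
   Context: $\mathbb{H}$ is the upper half plane; $(w,z)$ are the coordinates of $\mathbb{H}\times\mathbb{C}$ with $w=w_1+\sqrt{-1}\,w_2$ and $z=z_1+\sqrt{-1}\,z_2$. The group $G^{(+)}_{N,p,q,r;t}$: let $N=(n_{ij})\in SL(2,\mathbb{Z})$ have real eigenvalues $\alpha>1$ and $1/\alpha$, with real eigenvectors $(a_1,a_2)$ and $(b_1,b_2)$ for $\alpha$ and $1/\alpha$ respectively; let $p,q,r$ be integers with $r\neq0$, and let $(c_1,c_2)$ be the real solution of $$(c_1,c_2)=(c_1,c_2)N^{t}+(e_1,e_2)+\tfrac{b_1a_2-b_2a_1}{r}(p,q),$$ where $N^t$ is the transpose and $e_i=\frac12 n_{i1}(n_{i1}-1)a_1b_1+\frac12 n_{i2}(n_{i2}-1)a_2b_2+n_{i1}n_{i2}b_1a_2$ for $i=1,2$. Then $G^{(+)}_{N,p,q,r;t}$ is generated by $\phi_0(w,z)=(\alpha w,z+t)$, $\phi_i(w,z)=(w+a_i,\,z+b_iw+c_i)$ for $i=1,2$, and $\phi_3(w,z)=(w,\,z+\frac{b_1a_2-b_2a_1}{r})$. It acts freely and properly discontinuously with compact quotient. For $t\in\mathbb{R}$ the forms $\theta^1,\theta^2,\eta$ are $G^{(+)}_{N,p,q,r;t}$-invariant and so descend to $S_t^{(+)}$, as do the real 3-forms $i\,\theta^1\wedge\overline{\theta^1}\wedge dz_1$ and $i\,\theta^1\wedge\overline{\theta^1}\wedge dz_2$, which are $d_\eta$-closed. $\wedge^{1,1}_{\mathbb{R}}$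 etc. denote the smooth real forms of the indicated types. The form $\eta$ is the Lee form of Tricerri's locally conformally Kähler structure $\frac1i(\theta^1\wedge\overline{\theta^1}+\theta^2\wedge\overline{\theta^2})$. *)

(* Defs.v *)
From Stdlib Require Import Reals ZArith.
From mathcomp Require Import ssreflect ssrfun ssrbool eqtype ssrnat seq fintype bigop.
From Coquelicot Require Import Coquelicot.

Set Implicit Arguments.
Unset Strict Implicit.
Unset Printing Implicit Defensive.

Open Scope C_scope.

(** * The complex surface H x C *)

(* Points of [CC] are pairs [(w, z)], and tangent vectors are identified with
   elements of [CC] as well.  Maps and forms are total functions on [CC]; only
   their restriction to [HC] is meaningful, so all conditions below are
   imposed at points of [HC] only. *)
Definition CC : Type := (C * C)%type.

Definition HC (x : CC) : Prop := (0 < Im (fst x))%R.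

Definition line (x v : CC) (s : R) : CC :=
  (fst x + s * fst v, snd x + s * snd v).

Definition dirD (f : CC -> C) (v x : CC) : C :=
  (Derive (fun s => Re (f (line x v s))) 0,
   Derive (fun s => Im (f (line x v s))) 0).

Definition dirD_exists (f : CC -> C) (v x : CC) : Prop :=
  ex_derive (fun s => Re (f (line x v s))) 0 /\
  ex_derive (fun s => Im (f (line x v s))) 0.

Fixpoint class_C (m : nat) (f : CC -> C) : Prop :=
  (forall x, HC x -> continuous f x) /\
  match m with
  | O => True
  | S m' => forall v, (forall x, HC x -> dirD_exists f v x) /\
                      class_C m' (dirD f v)
  end.

Definition smooth (f : CC -> C) : Prop := forall m, class_C m f.

(** * Complex-valued differential forms *)

(* [cov k] also contains functions that are not alternating or not
   R-multilinear; [bidegree] below only holds for genuine exterior k-covectors. *)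
Definition cov (k : nat) : Type := ('I_k -> CC) -> C.

Definition form (k : nat) : Type := CC -> cov k.

Definition eq_form k (om om' : form k) : Prop :=
  forall x, HC x -> forall v, om x v = om' x v.

Definition cov1 (l : CC -> C) : cov 1 := fun v => l (v ord0).

(* Exterior product of a 1-covector with a k-covector, normalized so that
   (l1 /\ ... /\ lk)(v1, ..., vk) = det (li (vj)). *)
Definition wedge k (l : CC -> C) (tau : cov k) : cov k.+1 :=
  fun v => \big[Cplus/RtoC 0]_(i < k.+1)
    (RtoC ((-1) ^ i)%R * l (v i) * tau (fun j => v (lift i j))).

Definition ext_d k (om : form k) : form k.+1 :=
  fun x v => \big[Cplus/RtoC 0]_(i < k.+1)
    (RtoC ((-1) ^ i)%R * dirD (fun y => om y (fun j => v (lift i j))) (v i) x).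

Definition smooth_form k (om : form k) : Prop :=
  forall v, smooth (fun x => om x v).

Definition real_form k (om : form k) : Prop :=
  forall x, HC x -> forall v, Im (om x v) = 0%R.

(* [bidegree p q tau]: [tau] is in the complex span of the products of p
   covectors of the form [a dw + b dz] and q covectors of the form
   [a dw^* + b dz^*]. *)
Inductive bidegree : forall k, nat -> nat -> cov k -> Prop :=
| bidegree_cst (c : C) : @bidegree 0 0 0 (fun _ => c)
| bidegree_10 (a b : C) k p q (tau : cov k) :
    bidegree p q tau ->
    bidegree p.+1 q (wedge (fun u => a * fst u + b * snd u) tau)
| bidegree_01 (a b : C) k p q (tau : cov k) :
    bidegree p q tau ->
    bidegree p q.+1 (wedge (fun u => a * Cconj (fst u) + b * Cconj (snd u)) tau)
| bidegree_add k p q (tau tau' : cov k) :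
    bidegree p q tau -> bidegree p q tau' ->
    bidegree p q (fun v => tau v + tau' v).

Definition form11 (om : form 2) : Prop :=
  forall x, HC x -> bidegree 1 1 (om x).

Definition form21_12 (om : form 3) : Prop :=
  forall x, HC x -> exists tau tau' : cov 3,
    bidegree 2 1 tau /\ bidegree 1 2 tau' /\
    forall v, om x v = tau v + tau' v.

(** * Transformation groups and invariant forms *)

Definition tangent_map (g : CC -> CC) (x v : CC) : CC :=
  (dirD (fun y => fst (g y)) v x, dirD (fun y => snd (g y)) v x).

Definition pullback (g : CC -> CC) k (om : form k) : form k :=
  fun x v => om (g x) (fun i => tangent_map g x (v i)).

Inductive generated (S : (CC -> CC) -> Prop) : (CC -> CC) -> Prop :=
| generated_gen g : S g -> generated S g
| generated_id : generated S (fun x => x)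
| generated_comp g h :
    generated S g -> generated S h -> generated S (fun x => g (h x))
| generated_inv g h :
    generated S g -> cancel g h -> cancel h g -> generated S h.

(* For G acting freely and properly discontinuously on H x C, forms on the
   quotient are the same as G-invariant forms on H x C. *)
Definition invariant (G : (CC -> CC) -> Prop) k (om : form k) : Prop :=
  forall g, G g -> eq_form (pullback g om) om.

(** * The group of an Inoue surface of type S^(+) *)

Definition phi0 (alpha t : R) (x : CC) : CC :=
  (RtoC alpha * fst x, snd x + RtoC t).

(* phi_1 and phi_2 are [phi12 a_i b_i c_i]. *)
Definition phi12 (a b c : R) (x : CC) : CC :=
  (fst x + RtoC a, snd x + RtoC b * fst x + RtoC c).

Definition phi3 (kappa : R) (x : CC) : CC :=
  (fst x, snd x + RtoC kappa).

Definition inoue_kappa (a1 a2 b1 b2 : R) (r : Z) : R :=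
  ((b1 * a2 - b2 * a1) / IZR r)%R.

Definition inoue_group (alpha a1 a2 b1 b2 c1 c2 : R) (r : Z) (t : R) :
    (CC -> CC) -> Prop :=
  generated (fun g =>
    g = phi0 alpha t \/ g = phi12 a1 b1 c1 \/ g = phi12 a2 b2 c2 \/
    g = phi3 (inoue_kappa a1 a2 b1 b2 r)).

(* The number e_i attached to the i-th row (m1, m2) of N. *)
Definition inoue_e (a1 a2 b1 b2 : R) (m1 m2 : Z) : R :=
  (/ 2 * (IZR m1 * (IZR m1 - 1)) * a1 * b1 +
   / 2 * (IZR m2 * (IZR m2 - 1)) * a2 * b2 +
   IZR m1 * IZR m2 * b1 * a2)%R.

(** * Invariant forms and the twisted complex *)

Definition theta1 (x v : CC) : C := fst v / RtoC (Im (fst x)).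

Definition theta1_bar (x v : CC) : C := Cconj (theta1 x v).

Definition theta2 (x v : CC) : C :=
  RtoC (Im (snd x) / Im (fst x))%R * fst v - snd v.

Definition eta (x v : CC) : C := RtoC (Im (fst v) / Im (fst x))%R.

Definition dz1 (v : CC) : C := RtoC (Re (snd v)).
Definition dz2 (v : CC) : C := RtoC (Im (snd v)).

Definition d_eta k (om : form k) : form k.+1 :=
  fun x v => ext_d om x v - wedge (eta x) (om x) v.

Definition i_theta1_theta1bar_wedge (l : CC -> C) : form 3 :=
  fun x v => Ci * wedge (theta1 x) (wedge (theta1_bar x) (cov1 l)) v.

Definition real11 (G : (CC -> CC) -> Prop) (om : form 2) : Prop :=
  smooth_form om /\ real_form om /\ form11 om /\ invariant G om.

Definition real21_12 (G : (CC -> CC) -> Prop) (om : form 3) : Prop :=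
  smooth_form om /\ real_form om /\ form21_12 om /\ invariant G om.

Definition cocycle (G : (CC -> CC) -> Prop) (om : form 3) : Prop :=
  real21_12 G om /\ eq_form (d_eta om) (fun _ _ => RtoC 0).

Definition coboundary (G : (CC -> CC) -> Prop) (om : form 3) : Prop :=
  exists beta : form 2, real11 G beta /\ eq_form om (d_eta beta).

(* The class of [om] in ker d_eta / im d_eta is defined when [om] is a
   cocycle. *)
Definition class_vanishes (G : (CC -> CC) -> Prop) (om : form 3) : Prop :=
  cocycle G om /\ coboundary G om.

Definition class_nonzero (G : (CC -> CC) -> Prop) (om : form 3) : Prop :=
  cocycle G om /\ ~ coboundary G om.

(* Main.v *)
Require Import Defs.
From Stdlib Require Import Reals ZArith Lra Lia.
From Stdlib Require Import FunctionalExtensionality ClassicalEpsilon.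
From mathcomp Require Import ssreflect ssrfun ssrbool eqtype ssrnat seq fintype bigop.
From Coquelicot Require Import Coquelicot.

(** Write [w = x + i y] and [z = z1 + i z2].  On [H x C] the two 3-forms are
    [2 y^-2 dx /\ dy /\ dz_j].

    The first one is [d_eta] of [y^-1 (dx /\ dz1 + dy /\ dz2)], the real part
    of [y^-1 dw /\ dz^*].  Every element of the group is an affine map
    [(A w + B, z + b w + c)] with real coefficients and [A > 0], and this
    2-form is invariant under all such maps ([real11_primitive],
    [d_eta_primitive]).

    For the second one, the conceptual argument pairs a hypothetical primitive
    [beta] of type (1,1) with the invariant 1-form [e3 = (z2 / y) dx - dz1], the
    real part of [theta2].  The form [d e3 + eta /\ e3] is the imaginary part
    of [theta1 /\ theta2], so it has no component of type (1,1) and its product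
    with [beta] vanishes.  Hence [d (beta /\ e3)] is [d_eta beta /\ e3], a
    nonzero multiple of the invariant volume form, which Stokes' theorem
    forbids on a compact quotient.

    This is carried out on the covering.  Put [s = z2 / y] and write

      [beta = P dx /\ dy + Q dz1 /\ dz2 + S (dx /\ dz1 + dy /\ dz2)
              + T (dx /\ dz2 - dy /\ dz1)].

    The components of [beta] on the invariant frame
    [y (d/dx + s d/dz1)], [y (d/dy + s d/dz2)], [d/dz2], namely

      [a = y^2 (P + 2 s T + s^2 Q)],  [c = y S],  [d = y (T + s Q)],

    are invariant functions.  Invariant continuous functions are bounded,
    because the group moves every point into a fixed compact set
    ([bounded_of_invariant]).  The equation for [beta] says that a divergence
    is constant: [c_x - d_y + (a / y^2)_s = 2 / y] in suitable coordinates
    ([primitive_of_dz2_equation]).  All the functions are periodic in [z1].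
    Integrating over one period of [z1], over [0 <= x <= L] and over
    [1 <= y <= Y], the right-hand side gives [2 L ln Y] while the terms in [c]
    and [d] are boundary terms, bounded by multiples of [Y] and of [L].
    So for [Y] and then [L] large the integral of [a / y^2], a function of the
    remaining variable [s], has derivative at least 2.  It is also bounded, a
    contradiction ([no_bounded_flux]). *)

Set Implicit Arguments.
Unset Strict Implicit.
Unset Printing Implicit Defensive.
Local Open Scope R_scope.

(** * Integrals depending on a parameter *)

Lemma continuous_pair (U V W : UniformSpace) (f : U -> V) (g : U -> W) (u : U) :
  continuous f u -> continuous g u -> continuous (fun v => (f v, g v)) u.
Proof.
move=> cf cg; apply/filterlim_locally => eps.
have h := filter_and _ _ (proj1 (filterlim_locally _ _) cf eps)
  (proj1 (filterlim_locally _ _) cg eps).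
by case: h => r hr; exists r => v /hr [].
Qed.

Lemma continuous_Rplus (U : UniformSpace) (f g : U -> R) u :
  continuous f u -> continuous g u -> continuous (fun v => f v + g v) u.
Proof. exact: (@continuous_plus U R_AbsRing R_NormedModule). Qed.

Lemma continuous_Ropp (U : UniformSpace) (f : U -> R) u :
  continuous f u -> continuous (fun v => - f v) u.
Proof. exact: (@continuous_opp U R_AbsRing R_NormedModule). Qed.

Lemma continuous_Rmult (U : UniformSpace) (f g : U -> R) u :
  continuous f u -> continuous g u -> continuous (fun v => f v * g v) u.
Proof. exact: (@continuous_mult U R_AbsRing). Qed.

Lemma continuous_fst_comp (U V W : UniformSpace) (f : U -> V * W) u :
  continuous f u -> continuous (fun v => (f v).1) u.
Proof. by move=> cf; apply: (continuous_comp f fst) => //; exact: continuous_fst. Qed.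

Lemma continuous_snd_comp (U V W : UniformSpace) (f : U -> V * W) u :
  continuous f u -> continuous (fun v => (f v).2) u.
Proof. by move=> cf; apply: (continuous_comp f snd) => //; exact: continuous_snd. Qed.

Ltac cont_step := first
  [ assumption | exact: continuous_const | exact: filterlim_id
  | apply: continuous_Rplus | apply: continuous_Ropp | apply: continuous_Rmult
  | apply: continuous_pair | apply: continuous_fst_comp | apply: continuous_snd_comp ].
Ltac cont := repeat cont_step.

Lemma continuous_slice (U : UniformSpace) (f : R -> U -> R) (t : R) (u : U) :
  continuous (fun q : R * U => f q.1 q.2) (t, u) ->
  continuous (fun t' => f t' u) t.
Proof.
move=> cf; apply: (continuous_comp (fun t' => (t', u)) (fun q => f q.1 q.2)) => //.
by apply: continuous_pair; [exact: filterlim_id | exact: continuous_const].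
Qed.

(** The interval of integration is compact, so the continuity of [f] near
    [(t, u)] is uniform in [t]. *)
Lemma continuous_RInt_param (U : UniformSpace) (Ou : U -> Prop)
    (f : R -> U -> R) (a b : R) (u : U) :
  a <= b -> locally u Ou ->
  (forall t v, a <= t <= b -> Ou v -> continuous (fun q : R * U => f q.1 q.2) (t, v)) ->
  continuous (fun v => RInt (fun t => f t v) a b) u.
Proof.
move=> ab uO cfO.
have cf t (ht : a <= t <= b) := cfO t u ht (locally_singleton _ _ uO).
have slice : locally u (fun u' => forall t, a <= t <= b -> continuous (fun t => f t u') t).
  by apply: filter_imp uO => v hv t ht; apply: continuous_slice; apply: cfO.
apply/filterlim_locally => eps.
have e0 : 0 < eps / (2 * (b - a + 1)).
  apply: Rdiv_lt_0_compat; [exact: cond_pos | lra].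
pose e := mkposreal _ e0.
have ex_d t : exists d : posreal, a <= t <= b ->
    forall t' u', Rabs (t' - t) < d -> ball u d u' ->
      Rabs (f t' u' - f t u) < e.
  case: (excluded_middle_informative (a <= t <= b)) => ht; last first.
    by exists (mkposreal _ Rlt_0_1).
  have [d hd] := proj1 (filterlim_locally _ _) (cf t ht) e.
  exists d => _ t' u' h1 h2.
  by apply: (hd (t', u')); split.
pose delta t := proj1_sig (constructive_indefinite_description _ (ex_d t)).
have hdelta t := proj2_sig (constructive_indefinite_description _ (ex_d t)).
have [d hd] := compactness_value_1d a b delta.
have close_u t u' : a <= t <= b -> ball u d u' ->
    Rabs (f t u' - f t u) < 2 * e.
  move=> ht hu'.
  apply: NNPP => hn; apply: (hd t ht) => -[t0 [ht0 [tt0 dt0]]]; apply: hn.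
  have h1 := hdelta t0 ht0 t u' tt0 (ball_le u _ _ dt0 _ hu').
  have h2 := hdelta t0 ht0 t u tt0 (ball_center u _).
  move: h1 h2; move: (pos e) => ee.
  by rewrite /Rabs; do 3 case: Rcase_abs; lra.
have su := locally_singleton _ _ slice.
have ex_slice u' : (forall t, a <= t <= b -> continuous (fun t => f t u') t) ->
    ex_RInt (fun t => f t u') a b.
  move=> h; apply: ex_RInt_continuous => t.
  by rewrite Rmin_left // Rmax_right //; exact: h.
apply: (filter_imp _ _ _ (filter_and _ _ slice (locally_ball u d))) => u' [hs hb].
rewrite /ball /= /AbsRing_ball /abs /minus /= /plus /opp /=.
have -> : RInt (fun t => f t u') a b + - RInt (fun t => f t u) a b
    = RInt (fun t => f t u' - f t u) a b.
  by rewrite RInt_minus //; apply: ex_slice.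
apply: (Rle_lt_trans _ ((b - a) * (2 * e))).
  apply: abs_RInt_le_const => //.
    by apply: ex_RInt_minus; apply: ex_slice.
  by move=> t ht; apply: Rlt_le; apply: close_u.
have -> : (b - a) * (2 * e) = eps * ((b - a) / (b - a + 1)).
  rewrite /e /=; field; lra.
rewrite -[X in _ < X]Rmult_1_r; apply: Rmult_lt_compat_l; first exact: cond_pos.
apply/Rlt_div_l; lra.
Qed.

(** Leibniz's rule.  The open sets [Ot] and [Ou] allow for functions that are
    only controlled on the half-line of positive heights. *)
Lemma is_derive_RInt_cont (Ot Ou : R -> Prop) (f f' : R -> R -> R) (a b u : R) :
  a <= b -> (forall t, a <= t <= b -> locally t Ot) -> locally u Ou ->
  (forall t v, Ot t -> Ou v -> is_derive (f t) v (f' t v)) ->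
  (forall t, a <= t <= b -> continuous (fun q : R * R => f' q.1 q.2) (t, u)) ->
  (forall t v, a <= t <= b -> Ou v -> continuous (fun q : R * R => f q.1 q.2) (t, v)) ->
  is_derive (fun v => RInt (fun t => f t v) a b) u (RInt (fun t => f' t u) a b).
Proof.
move=> ab tO uO der cf' cf.
have inO t (ht : a <= t <= b) := locally_singleton _ _ (tO t ht).
have -> : RInt (fun t => f' t u) a b
    = RInt (fun t => Derive (fun v => f t v) u) a b.
  apply: RInt_ext => t; rewrite Rmin_left // Rmax_right // => ht.
  apply/esym/is_derive_unique; apply: der; last exact: locally_singleton uO.
  by apply: inO; lra.
apply: (is_derive_RInt_param (fun v t => f t v)).
- apply: filter_imp uO => v hv t; rewrite Rmin_left // Rmax_right // => ht.
  by exists (f' t v); apply: der => //; apply: inO.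
- move=> t; rewrite Rmin_left // Rmax_right // => ht.
  apply/continuity_2d_pt_filterlim.
  have near : locally ((u, t) : R * R) (fun q => Ou q.1 /\ Ot q.2).
    case: uO => d1 h1; case: (tO t ht) => d2 h2.
    have d0 : 0 < Rmin d1 d2 by apply: Rmin_pos; apply: cond_pos.
    exists (mkposreal _ d0) => q [q1 q2]; split.
    + by apply: h1; apply: ball_le q1; apply: Rmin_l.
    + by apply: h2; apply: ball_le q2; apply: Rmin_r.
  have eqD : forall q : R * R, Ou q.1 /\ Ot q.2 ->
      f' q.2 q.1 = Derive (fun z => f q.2 z) q.1.
    by move=> q [q1 q2]; apply/esym/is_derive_unique; apply: der.
  rewrite -(eqD (u, t)); last exact: locally_singleton near.
  apply: (filterlim_ext_loc (fun q : R * R => f' q.2 q.1)).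
    by apply: filter_imp near => q; exact: eqD.
  apply: (continuous_comp (fun q : R * R => (q.2, q.1)) (fun q => f' q.1 q.2)).
    by apply: continuous_pair; [exact: continuous_snd | exact: continuous_fst].
  exact: cf'.
- apply: filter_imp uO => v hv; apply: ex_RInt_continuous => t.
  rewrite Rmin_left // Rmax_right // => ht.
  by apply: continuous_slice; apply: cf.
Qed.

Lemma is_RInt_of_derivative (f f' : R -> R) (a b : R) :
  a <= b -> (forall x, a <= x <= b -> is_derive f x (f' x)) ->
  (forall x, a <= x <= b -> continuous f' x) ->
  is_RInt f' a b (f b - f a).
Proof.
move=> ab der cf'.
apply: (@is_RInt_derive R_CompleteNormedModule f f' a b) => x;
  rewrite Rmin_left // Rmax_right //; [exact: der | exact: cf'].
Qed.

Lemma RInt_periodic_shift (f : R -> R) (c : R) :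
  (forall t, continuous f t) -> (forall t, f (t + 1) = f t) ->
  RInt (fun t => f (t + c)) 0 1 = RInt f 0 1.
Proof.
move=> cf per.
have ex a b : ex_RInt f a b by apply: ex_RInt_continuous => z _; exact: cf.
have shift a b d : RInt (fun t => f (t + d)) a b = RInt f (a + d) (b + d).
  have := @RInt_comp_lin R_CompleteNormedModule f 1 d a b.
  rewrite !Rmult_1_l => <- //.
  by apply: RInt_ext => t _; rewrite /scal /= /mult /= !Rmult_1_l.
rewrite shift.
have <- := @RInt_Chasles R_CompleteNormedModule f (0 + c) 0 (1 + c) (ex _ _) (ex _ _).
have <- := @RInt_Chasles R_CompleteNormedModule f 0 1 (1 + c) (ex _ _) (ex _ _).
have -> : RInt f 1 (1 + c) = RInt f 0 c.
  rewrite -[X in RInt f X _](Rplus_0_l 1) (Rplus_comm 1 c) -(shift 0 c 1).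
  by apply: RInt_ext => t _; exact: per.
have h := @RInt_Chasles R_CompleteNormedModule f 0 c 0 (ex _ _) (ex _ _).
move: h; rewrite RInt_point /plus /zero /= Rplus_0_l => h; lra.
Qed.

(** * Integrals over a period times an interval *)

(** The integrands below depend on a periodic variable [t], on [x], and on
    further parameters [u] that range over an open set. *)
Definition jointly_continuous (U : UniformSpace) (Ou : U -> Prop)
    (f : R -> R -> U -> R) : Prop :=
  forall t x u, Ou u ->
    continuous (fun q : R * (R * U) => f q.1 q.2.1 q.2.2) (t, (x, u)).

(** The variable [t] has period 1, so this is an average over a circle. *)
Definition mean_circle (U : UniformSpace) (f : R -> R -> U -> R) (x : R) (u : U) : R :=
  RInt (fun t => f t x u) 0 1.

Definition strip_integral (U : UniformSpace) (L : R) (f : R -> R -> U -> R) (u : U) : R :=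
  RInt (fun x => mean_circle f x u) 0 L.

Lemma locally_snd (U : UniformSpace) (Ou : U -> Prop) (x : R) (u : U) :
  locally u Ou -> locally ((x, u) : R * U) (fun q => Ou q.2).
Proof. by case=> d hd; exists d => q [_ q2]; exact: hd. Qed.

Section StripIntegral.

Context (U : UniformSpace) (Ou : U -> Prop) (Ou_open : forall u, Ou u -> locally u Ou).

Lemma continuous_mean_circle (f : R -> R -> U -> R) x u :
  jointly_continuous Ou f -> Ou u ->
  continuous (fun q : R * U => mean_circle f q.1 q.2) (x, u).
Proof.
move=> cf uO.
apply: (@continuous_RInt_param _ (fun q : R * U => Ou q.2)
  (fun t q => f t q.1 q.2)); first lra.
- exact: locally_snd (Ou_open uO).
- move=> t [x' v] _ vO; exact: cf.
Qed.

Lemma continuous_strip_integral L (f : R -> R -> U -> R) u :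
  0 <= L -> jointly_continuous Ou f -> Ou u -> continuous (strip_integral L f) u.
Proof.
move=> L0 cf uO.
apply: (@continuous_RInt_param _ Ou (mean_circle f)) => //; first exact: Ou_open.
by move=> x v _ vO; apply: continuous_mean_circle.
Qed.

Lemma jointly_continuous_slice (f : R -> R -> U -> R) t x u :
  jointly_continuous Ou f -> Ou u -> continuous (fun t => f t x u) t.
Proof.
move=> cf uO.
by apply: (@continuous_slice _ (fun t q => f t q.1 q.2) t ((x, u) : R * U)); apply: cf.
Qed.

Lemma ex_RInt_circle (f : R -> R -> U -> R) x u :
  jointly_continuous Ou f -> Ou u -> ex_RInt (fun t => f t x u) 0 1.
Proof.
move=> cf uO; apply: ex_RInt_continuous => t _.
exact: jointly_continuous_slice cf uO.
Qed.

Lemma ex_RInt_strip (f : R -> R -> U -> R) L u :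
  jointly_continuous Ou f -> Ou u -> ex_RInt (fun x => mean_circle f x u) 0 L.
Proof.
move=> cf uO; apply: ex_RInt_continuous => x _.
by apply: (@continuous_slice _ (mean_circle f)); apply: continuous_mean_circle.
Qed.

Lemma mean_circle_le (f : R -> R -> U -> R) x u M :
  jointly_continuous Ou f -> Ou u -> (forall t, Rabs (f t x u) <= M) ->
  Rabs (mean_circle f x u) <= M.
Proof.
move=> cf uO fM.
have := @abs_RInt_le_const (fun t => f t x u) 0 1 M Rle_0_1 (ex_RInt_circle x cf uO).
by rewrite Rminus_0_r Rmult_1_l; apply => t _.
Qed.

Lemma strip_integral_le (f : R -> R -> U -> R) L u M :
  0 <= L -> jointly_continuous Ou f -> Ou u ->
  (forall t x, Rabs (f t x u) <= M) -> Rabs (strip_integral L f u) <= L * M.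
Proof.
move=> L0 cf uO fM.
have := @abs_RInt_le_const (fun x => mean_circle f x u) 0 L M L0 (ex_RInt_strip L cf uO).
by rewrite Rminus_0_r; apply => x _; apply: mean_circle_le.
Qed.

End StripIntegral.

Lemma is_derive_mean_circle (Ou : R -> Prop) (Ou_open : forall u, Ou u -> locally u Ou)
    (f f' : R -> R -> R -> R) x u :
  jointly_continuous Ou f -> jointly_continuous Ou f' ->
  (forall t x v, Ou v -> is_derive (f t x) v (f' t x v)) -> Ou u ->
  is_derive (mean_circle f x) u (mean_circle f' x u).
Proof.
move=> cf cf' der uO.
have slice (g : R -> R -> R -> R) t v : jointly_continuous Ou g -> Ou v ->
    continuous (fun q : R * R => g q.1 x q.2) (t, v).
  move=> cg vO.
  apply: (continuous_comp (fun q : R * R => (q.1, (x, q.2)))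
    (fun q => g q.1 q.2.1 q.2.2)); last exact: cg.
  by cont.
apply: (@is_derive_RInt_cont (fun _ => True) Ou (fun t => f t x) (fun t => f' t x)) => //.
- lra.
- by move=> *; exact: filter_true.
- exact: Ou_open.
- by move=> t v _ vO; exact: der.
- by move=> t _; apply: slice.
- by move=> t v _ vO; apply: slice.
Qed.

Lemma is_derive_strip_integral (Ou : R -> Prop) (Ou_open : forall u, Ou u -> locally u Ou)
    (f f' : R -> R -> R -> R) L u :
  0 <= L -> jointly_continuous Ou f -> jointly_continuous Ou f' ->
  (forall t x v, Ou v -> is_derive (f t x) v (f' t x v)) -> Ou u ->
  is_derive (strip_integral L f) u (strip_integral L f' u).
Proof.
move=> L0 cf cf' der uO.
apply: (@is_derive_RInt_cont (fun _ => True) Ou (mean_circle f) (mean_circle f')) => //.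
- by move=> *; exact: filter_true.
- exact: Ou_open.
- by move=> x v _ vO; apply: (@is_derive_mean_circle Ou Ou_open f f').
- by move=> x _; apply: (continuous_mean_circle Ou_open).
- by move=> x v _ vO; apply: (continuous_mean_circle Ou_open).
Qed.

(** * An integrated divergence identity *)

Lemma locally_pos (y : R) : 0 < y -> locally y (Rlt 0).
Proof. exact: open_gt. Qed.

Lemma locally_pos_fst (p : R * R) : 0 < p.1 -> locally p (fun p => 0 < p.1).
Proof.
by case: p => y s /= /locally_pos[d hd]; exists d => q [q1 _]; exact: hd.
Qed.

Lemma jointly_continuous_swap (f : R -> R -> R -> R) y :
  jointly_continuous (Rlt 0) f -> 0 < y ->
  jointly_continuous (fun _ : R => True) (fun t (_ : R) x => f t x y).
Proof.
move=> cf y0 t x0 x _.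
apply: (continuous_comp (fun q : R * (R * R) => (q.1, (q.2.2, y)))
  (fun q => f q.1 q.2.1 q.2.2)); last exact: cf.
by cont.
Qed.

(** Leibniz's rule moves the derivative in [x] out of the integral over [t];
    the fundamental theorem of calculus then leaves the two ends. *)
Lemma strip_integral_x_derivative (L y : R) (c c' : R -> R -> R -> R) :
  0 <= L -> 0 < y ->
  jointly_continuous (Rlt 0) c -> jointly_continuous (Rlt 0) c' ->
  (forall t x, is_derive (fun x => c t x y) x (c' t x y)) ->
  strip_integral L c' y = mean_circle c L y - mean_circle c 0 y.
Proof.
move=> L0 y0 cc cc' der.
have dm x : is_derive (fun x => mean_circle c x y) x (mean_circle c' x y).
  apply: (@is_derive_mean_circle (fun _ => True) _
    (fun t _ x => c t x y) (fun t _ x => c' t x y) 0 x) => //.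
  - by move=> *; exact: filter_true.
  - exact: jointly_continuous_swap.
  - exact: jointly_continuous_swap.
apply: is_RInt_unique.
apply: (@is_RInt_of_derivative (fun x => mean_circle c x y) (fun x => mean_circle c' x y)) => // x _.
apply: (@continuous_slice _ (mean_circle c')).
exact: (continuous_mean_circle locally_pos).
Qed.

(** The equation relates [f] at the time [t + rho x] to the other functions at
    the time [t]; the shift disappears in the integral over a period. *)
Lemma strip_balance (L y : R) (f c c' d' : R -> R -> R -> R) (rho : R -> R) :
  0 <= L -> 0 < y ->
  jointly_continuous (Rlt 0) f -> 
  jointly_continuous (Rlt 0) c -> jointly_continuous (Rlt 0) c' ->
  jointly_continuous (Rlt 0) d' ->
  (forall t x, is_derive (fun x => c t x y) x (c' t x y)) ->
  (forall t x, f (t + 1) x y = f t x y) ->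
  (forall t x, f (t + rho x) x y + c' t x y - d' t x y = 2 / y) ->
  strip_integral L f y = L * (2 / y) - (mean_circle c L y - mean_circle c 0 y)
    + strip_integral L d' y.
Proof.
move=> L0 y0 cf cc cc' cd' der per eq.
rewrite -(strip_integral_x_derivative L0 y0 cc cc' der).
have ec x := ex_RInt_circle x cc' y0.
have ed x := ex_RInt_circle x cd' y0.
have sc := ex_RInt_strip locally_pos L cc' y0.
have sd := ex_RInt_strip locally_pos L cd' y0.
have k2 : L * (2 / y) = RInt (fun _ => 2 / y) 0 L.
  by rewrite RInt_const /scal /= /mult /=; ring.
have circ x : mean_circle f x y = 2 / y - mean_circle c' x y + mean_circle d' x y.
  have eq' t : f (t + rho x) x y = 2 / y - c' t x y + d' t x y.
    by rewrite -(eq t x); ring.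
  have cfx t : continuous (fun t => f t x y) t.
    exact: (jointly_continuous_slice (Ou := Rlt 0)).
  rewrite /mean_circle -(@RInt_periodic_shift _ (rho x) cfx) //.
  rewrite (RInt_ext _ (fun t => 2 / y - c' t x y + d' t x y)); last first.
    by move=> t _; exact: eq'.
  have e2 : ex_RInt (fun _ : R => 2 / y) 0 1 by exact: ex_RInt_const.
  have e3 : ex_RInt (fun t => 2 / y - c' t x y) 0 1.
    exact: (ex_RInt_minus _ _ _ _ e2 (ec x)).
  rewrite (RInt_plus (fun t => 2 / y - c' t x y) (fun t => d' t x y)) //.
  rewrite (RInt_minus (fun t => 2 / y) (fun t => c' t x y)) //.
  by rewrite RInt_const /scal /minus /plus /opp /= /mult /=; ring.
rewrite /strip_integral (RInt_ext _ (fun x => 2 / y - mean_circle c' x y + mean_circle d' x y)); last first.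
  by move=> x _; exact: circ.
have e2 : ex_RInt (fun _ : R => 2 / y) 0 L by exact: ex_RInt_const.
have e3 : ex_RInt (fun x => 2 / y - mean_circle c' x y) 0 L.
  exact: (ex_RInt_minus _ _ _ _ e2 sc).
rewrite (RInt_plus (fun x => 2 / y - mean_circle c' x y) (fun x => mean_circle d' x y)) //.
rewrite (RInt_minus (fun x => 2 / y) (fun x => mean_circle c' x y)) //.
by rewrite -k2.
Qed.

(** The divergence theorem on the box [0, 1] x [0, L] x [1, Y] in the variables
    [t], [x], [y], with the last variable [s] kept as a parameter.  The integral
    of [2 / y] over the box, [2 L ln Y], dominates the fluxes of [c] and [d]
    through the faces as soon as [ln Y > M] and [L] is large compared with
    [M Y].  Then the integral of [a] grows at least linearly in [s], although
    it stays bounded. *)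
Lemma no_bounded_flux (M : R) (rho : R -> R -> R)
    (a a' : R -> R -> R -> R -> R) (c c' d d' : R -> R -> R -> R -> R) :
  jointly_continuous (fun p : R * R => 0 < p.1) (fun t x p => a t x p.1 p.2) ->
  jointly_continuous (fun p : R * R => 0 < p.1) (fun t x p => a' t x p.1 p.2) ->
  (forall s, jointly_continuous (Rlt 0) (c s)) ->
  (forall s, jointly_continuous (Rlt 0) (c' s)) ->
  (forall s, jointly_continuous (Rlt 0) (d s)) ->
  (forall s, jointly_continuous (Rlt 0) (d' s)) ->
  (forall t x y s, 0 < y -> is_derive (a t x y) s (a' t x y s)) ->
  (forall s t x y, 0 < y -> is_derive (fun x => c s t x y) x (c' s t x y)) ->
  (forall s t x y, 0 < y -> is_derive (d s t x) y (d' s t x y)) ->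
  (forall t x y s, 0 < y -> a' (t + 1) x y s = a' t x y s) ->
  (forall t x y s, 0 < y ->
     a' (t + rho x s) x y s + c' s t x y - d' s t x y = 2 / y) ->
  (forall t x y s, 1 <= y -> Rabs (a t x y s) <= M) ->
  (forall s t x y, 1 <= y -> Rabs (c s t x y) <= M) ->
  (forall s t x y, 1 <= y -> Rabs (d s t x y) <= M) ->
  False.
Proof.
move=> ca ca' cc cc' cd cd' da dc dd per eq aM cM dM.
have M0 : 0 <= M by apply: Rle_trans (aM 0 0 1 0 (Rle_refl 1)); apply: Rabs_pos.
(* The derivative of [h] below is at least
   [2 L ln Y - 2 M (Y - 1) - 2 L M = 2 L - 2 M (Y - 1)]. *)
pose Y := exp (M + 1); pose L := M * Y + 1.
have Y1 : 1 < Y by rewrite -exp_0; apply: exp_increasing; lra.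
have lnY : ln Y = M + 1 by rewrite ln_exp.
have L0 : 0 < L by rewrite /L; have := Rmult_le_pos M Y M0; lra.
have L0' := Rlt_le _ _ L0.
(* The integrals are differentiated in one real variable at a time, so the
   pair (y, s) has to be cut into its two slices. *)
have slice_s f y : jointly_continuous (fun p : R * R => 0 < p.1) (fun t x p => f t x p.1 p.2) ->
    0 < y -> jointly_continuous (fun _ : R => True) (fun t x s => f t x y s).
  move=> cf y0 t x s _.
  apply: (continuous_comp (fun q : R * (R * R) => (q.1, (q.2.1, (y, q.2.2))))
    (fun q => f q.1 q.2.1 q.2.2.1 q.2.2.2)); last exact: (cf t x (y, s)).
  by cont.
have slice_y f s : jointly_continuous (fun p : R * R => 0 < p.1) (fun t x p => f t x p.1 p.2) ->
    jointly_continuous (Rlt 0) (fun t x y => f t x y s).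
  move=> cf t x y y0.
  apply: (continuous_comp (fun q : R * (R * R) => (q.1, (q.2.1, (q.2.2, s))))
    (fun q => f q.1 q.2.1 q.2.2.1 q.2.2.2)); last exact: (cf t x (y, s)).
  by cont.
pose strip f y s := strip_integral L (fun t x (p : R * R) => f t x p.1 p.2) (y, s).
pose h s := RInt (fun y => strip a y s) 1 Y.
pose h' s := RInt (fun y => strip a' y s) 1 Y.
have dh s : is_derive h s (h' s).
  apply: (@is_derive_RInt_cont (Rlt 0) (fun _ => True) (strip a) (strip a')).
  - lra.
  - by move=> y hy; apply: locally_pos; lra.
  - exact: filter_true.
  - move=> y v y0 _.
    apply: (@is_derive_strip_integral (fun _ => True) _ (fun t x s => a t x y s)
      (fun t x s => a' t x y s)) => //.
    + by move=> *; exact: filter_true.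
    + exact: slice_s.
    + exact: slice_s.
    + by move=> t x w _; exact: da.
  - move=> y hy.
    apply: (continuous_ext (strip_integral L (fun t x (p : R * R) => a' t x p.1 p.2))).
      by case.
    apply: (continuous_strip_integral locally_pos_fst) => //=; lra.
  - move=> y v hy _.
    apply: (continuous_ext (strip_integral L (fun t x (p : R * R) => a t x p.1 p.2))).
      by case.
    apply: (continuous_strip_integral locally_pos_fst) => //=; lra.
have h_le s : Rabs (h s) <= (Y - 1) * (L * M).
  apply: abs_RInt_le_const; first lra.
    apply: ex_RInt_continuous => y; rewrite Rmin_left ?Rmax_right; [|lra|lra] => hy.
    apply: (continuous_strip_integral locally_pos) => //; last lra.
    exact: slice_y.
  move=> y hy; apply: (strip_integral_le (Ou := fun p : R * R => 0 < p.1)) => //=.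
  - exact: locally_pos_fst.
  - lra.
  - by move=> t x; apply: aM; lra.
have h'_ge s : 2 <= h' s.
  have cstrip f : jointly_continuous (Rlt 0) f -> ex_RInt (strip_integral L f) 1 Y.
    move=> cf; apply: ex_RInt_continuous => y; rewrite Rmin_left ?Rmax_right; [|lra|lra] => hy.
    by apply: (continuous_strip_integral locally_pos) => //; lra.
  pose e y := strip_integral L (c' s) y.
  have eE y : 1 <= y -> strip a' y s = L * 2 / y - e y + strip_integral L (d' s) y.
    move=> y1.
    have -> : strip a' y s = strip_integral L (fun t x y => a' t x y s) y by [].
    rewrite (@strip_balance L y (fun t x y => a' t x y s) (c s) (c' s) (d' s)
      (fun x => rho x s)) //; try lra; try exact: slice_y.
    + rewrite -(strip_integral_x_derivative (c := c s) (c' := c' s)) //; try lra.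
      * by rewrite /e /Rdiv; ring.
      * by move=> t x; apply: dc; lra.
    + by move=> t x; apply: dc; lra.
    + by move=> t x; apply: per; lra.
    + by move=> t x; apply: eq; lra.
  have e_le y : 1 <= y -> Rabs (e y) <= 2 * M.
    move=> y1; rewrite /e (strip_integral_x_derivative (c := c s)) //; try lra; last first.
      by move=> t x; apply: dc; lra.
    have m_le x : Rabs (mean_circle (c s) x y) <= M.
      apply: (mean_circle_le (Ou := Rlt 0)) => //; first lra.
      by move=> t; apply: cM.
    have := m_le L; have := m_le 0.
    by move=> /Rabs_le_between ? /Rabs_le_between ?; apply/Rabs_le_between; lra.
  have ed := cstrip _ (cd' s).
  have ee : ex_RInt e 1 Y := cstrip _ (cc' s).
  have rl : is_RInt (fun y => L * 2 / y) 1 Y (L * 2 * ln Y - L * 2 * ln 1).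
    apply: (@is_RInt_of_derivative (fun y => L * 2 * ln y)) => [|y hy|y hy]; first lra.
    - by auto_derive; [lra | field; lra].
    - apply: ex_derive_continuous; auto_derive; lra.
  have rd : is_RInt (strip_integral L (d' s)) 1 Y
      (strip_integral L (d s) Y - strip_integral L (d s) 1).
    apply: (@is_RInt_of_derivative (strip_integral L (d s))) => [|y hy|y hy]; first lra.
    - apply: (is_derive_strip_integral locally_pos) => //; last lra.
      by move=> t x v; exact: dd.
    - by apply: (continuous_strip_integral locally_pos) => //; lra.
  have -> : h' s = L * 2 * ln Y - RInt e 1 Y
      + (strip_integral L (d s) Y - strip_integral L (d s) 1).
    rewrite /h' (RInt_ext _ (fun y => L * 2 / y - e y + strip_integral L (d' s) y)); last first.
      by move=> y; rewrite Rmin_left ?Rmax_right; [|lra|lra] => hy; apply: eE; lra.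
    apply: is_RInt_unique.
    apply: (is_RInt_plus (fun y => L * 2 / y - e y) (strip_integral L (d' s))) => //.
    apply: (is_RInt_minus (fun y => L * 2 / y) e); last exact: RInt_correct.
    by rewrite ln_1 Rmult_0_r Rminus_0_r in rl.
  have b1 : Rabs (RInt e 1 Y) <= (Y - 1) * (2 * M).
    apply: abs_RInt_le_const => //; first lra.
    by move=> y hy; apply: e_le; lra.
  have b2 y : 1 <= y -> Rabs (strip_integral L (d s) y) <= L * M.
    move=> y1; apply: (strip_integral_le (Ou := Rlt 0)) => //.
    - exact: locally_pos.
    - lra.
    - by move=> t x; apply: dM.
  have := b2 1 (Rle_refl 1); have := b2 Y (Rlt_le _ _ Y1).
  move: b1 => /Rabs_le_between b1 /Rabs_le_between b3 /Rabs_le_between b4.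
  by rewrite lnY; move: b1 b3 b4; rewrite /L; nra.
(* The oscillation of [h] is at most [2 (Y - 1) L M], less than [2 S]. *)
pose S := (Y - 1) * (L * M) + 1.
have S0 : 0 < S by rewrite /S; have := Rabs_pos (h 0); have := h_le 0; lra.
have [x [_ hx]] := MVT_gen h 0 S h' (fun x _ => dh x)
  (fun x _ => derivable_continuous_pt _ _ (ex_derive_Reals_0 _ _ (ex_intro _ _ (dh x)))).
have := h_le 0; have := h_le S => /Rabs_le_between b1 /Rabs_le_between b2.
have := h'_ge x; rewrite Rminus_0_r in hx => h2.
have : 2 * S <= h' x * S by apply: Rmult_le_compat_r; lra.
by rewrite -hx /S in b1 b2 *; lra.
Qed.

(** * Exterior products evaluated on explicit vectors *)

(** Forms act on functions ['I_k -> CC].  Presenting their arguments by lists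
    makes the omission of an argument a computation on lists. *)
Definition tup (s : seq CC) (k : nat) : 'I_k -> CC :=
  fun i => nth (RtoC 0, RtoC 0) s i.

Arguments tup : simpl never.

Lemma tup_lift (s : seq CC) (k : nat) (i : 'I_k.+1) : (size s = k.+1)%N ->
  (fun j => @tup s k.+1 (lift i j)) = @tup (take i s ++ drop i.+1 s) k.
Proof.
move=> sz; apply: functional_extensionality => j.
rewrite /tup /= nth_cat size_take sz ltn_ord /bump.
case: (leqP i j) => ij; first by rewrite nth_drop addSn subnKC.
by rewrite nth_take.
Qed.

Lemma tup2_eta (v : 'I_2 -> CC) : exists u0 u1, v = @tup [:: u0; u1] 2.
Proof.
exists (v (inord 0)), (v (inord 1)); apply: functional_extensionality.
by move=> [[|[|//]] p]; rewrite /tup /=; congr v; apply: val_inj; rewrite /= inordK.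
Qed.

Lemma tup3_eta (v : 'I_3 -> CC) : exists u0 u1 u2, v = @tup [:: u0; u1; u2] 3.
Proof.
exists (v (inord 0)), (v (inord 1)), (v (inord 2)); apply: functional_extensionality.
by move=> [[|[|[|//]]] p]; rewrite /tup /=; congr v; apply: val_inj; rewrite /= inordK.
Qed.

Lemma tup4_eta (v : 'I_4 -> CC) : exists u0 u1 u2 u3, v = @tup [:: u0; u1; u2; u3] 4.
Proof.
exists (v (inord 0)), (v (inord 1)), (v (inord 2)), (v (inord 3)).
apply: functional_extensionality.
by move=> [[|[|[|[|//]]]] p]; rewrite /tup /=; congr v; apply: val_inj; rewrite /= inordK.
Qed.

Lemma RtoC_sign_0 : RtoC ((-1) ^ 0) = 1%C. Proof. by []. Qed.

Lemma RtoC_signS k : RtoC ((-1) ^ k.+1) = (- RtoC ((-1) ^ k))%C.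
Proof. by rewrite -RtoC_opp; congr RtoC; rewrite /=; ring. Qed.

Definition RtoC_sign := (RtoC_signS, RtoC_sign_0).

Lemma wedge_tup1 l (tau : cov 0) u0 :
  wedge l tau (@tup [:: u0] 1) = (l u0 * tau (@tup [::] 0))%C.
Proof.
rewrite /wedge !big_ord_recl big_ord0 !tup_lift // !RtoC_sign.
by transitivity (1 * l u0 * tau (@tup [::] 0) + 0)%C; last ring.
Qed.

Lemma wedge_tup2 l (tau : cov 1) u0 u1 :
  wedge l tau (@tup [:: u0; u1] 2)
  = (l u0 * tau (@tup [:: u1] 1) - l u1 * tau (@tup [:: u0] 1))%C.
Proof.
rewrite /wedge !big_ord_recl big_ord0 !tup_lift // !RtoC_sign.
by transitivity (1 * l u0 * tau (@tup [:: u1] 1)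
  + (- (1) * l u1 * tau (@tup [:: u0] 1) + 0))%C; last ring.
Qed.

Lemma wedge_tup3 l (tau : cov 2) u0 u1 u2 :
  wedge l tau (@tup [:: u0; u1; u2] 3)
  = (l u0 * tau (@tup [:: u1; u2] 2) - l u1 * tau (@tup [:: u0; u2] 2)
     + l u2 * tau (@tup [:: u0; u1] 2))%C.
Proof.
rewrite /wedge !big_ord_recl big_ord0 !tup_lift // !RtoC_sign.
by transitivity (1 * l u0 * tau (@tup [:: u1; u2] 2)
  + (- (1) * l u1 * tau (@tup [:: u0; u2] 2)
  + (- - (1) * l u2 * tau (@tup [:: u0; u1] 2) + 0)))%C; last ring.
Qed.

Lemma wedge_tup4 l (tau : cov 3) u0 u1 u2 u3 :
  wedge l tau (@tup [:: u0; u1; u2; u3] 4)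
  = (l u0 * tau (@tup [:: u1; u2; u3] 3) - l u1 * tau (@tup [:: u0; u2; u3] 3)
     + l u2 * tau (@tup [:: u0; u1; u3] 3) - l u3 * tau (@tup [:: u0; u1; u2] 3))%C.
Proof.
rewrite /wedge !big_ord_recl big_ord0 !tup_lift // !RtoC_sign.
by transitivity (1 * l u0 * tau (@tup [:: u1; u2; u3] 3)
  + (- (1) * l u1 * tau (@tup [:: u0; u2; u3] 3)
  + (- - (1) * l u2 * tau (@tup [:: u0; u1; u3] 3)
  + (- - - (1) * l u3 * tau (@tup [:: u0; u1; u2] 3) + 0))))%C; last ring.
Qed.

Lemma ext_d_big k (om : form k) x (s : seq CC) : size s = k.+1 ->
  ext_d om x (@tup s k.+1)
  = \big[Cplus/RtoC 0]_(i < k.+1)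
      (RtoC ((-1) ^ i)%R * dirD (fun y => om y (@tup (take i s ++ drop i.+1 s) k))
        (@tup s k.+1 i) x)%C.
Proof. by move=> sz; apply: eq_bigr => i _; rewrite tup_lift. Qed.

Lemma ext_d_tup3 (om : form 2) x u0 u1 u2 :
  ext_d om x (@tup [:: u0; u1; u2] 3)
  = (dirD (fun y => om y (@tup [:: u1; u2] 2)) u0 x
     - dirD (fun y => om y (@tup [:: u0; u2] 2)) u1 x
     + dirD (fun y => om y (@tup [:: u0; u1] 2)) u2 x)%C.
Proof.
rewrite ext_d_big // !big_ord_recl big_ord0 !RtoC_sign.
by transitivity (1 * dirD (fun y => om y (@tup [:: u1; u2] 2)) u0 x
  + (- (1) * dirD (fun y => om y (@tup [:: u0; u2] 2)) u1 x
  + (- - (1) * dirD (fun y => om y (@tup [:: u0; u1] 2)) u2 x + 0)))%C; last ring.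
Qed.

Lemma ext_d_tup4 (om : form 3) x u0 u1 u2 u3 :
  ext_d om x (@tup [:: u0; u1; u2; u3] 4)
  = (dirD (fun y => om y (@tup [:: u1; u2; u3] 3)) u0 x
     - dirD (fun y => om y (@tup [:: u0; u2; u3] 3)) u1 x
     + dirD (fun y => om y (@tup [:: u0; u1; u3] 3)) u2 x
     - dirD (fun y => om y (@tup [:: u0; u1; u2] 3)) u3 x)%C.
Proof.
rewrite ext_d_big // !big_ord_recl big_ord0 !RtoC_sign.
by transitivity (1 * dirD (fun y => om y (@tup [:: u1; u2; u3] 3)) u0 x
  + (- (1) * dirD (fun y => om y (@tup [:: u0; u2; u3] 3)) u1 x
  + (- - (1) * dirD (fun y => om y (@tup [:: u0; u1; u3] 3)) u2 x
  + (- - - (1) * dirD (fun y => om y (@tup [:: u0; u1; u2] 3)) u3 x + 0))))%C; last ring.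
Qed.

(** * Forms whose coefficients are powers of the height, and the affine group *)

Lemma HC_open x : HC x -> locally x HC.
Proof.
rewrite /HC => x0; exists (mkposreal _ x0) => y [[_ b] _].
move: b; rewrite /ball /= /AbsRing_ball /abs /minus /plus /opp /=.
by rewrite /Im => /Rabs_lt_between; lra.
Qed.

Lemma Im_line x v s : Im (fst (line x v s)) = Im (fst x) + s * Im (fst v).
Proof. by case: x v => [[? ?] ?] [[? ?] ?]; rewrite /line /Im /=; ring. Qed.

Lemma line0 x v : line x v 0 = x.
Proof.
by case: x v => [[? ?] [? ?]] [[? ?] [? ?]]; rewrite /line /Cplus /Cmult /=;
  congr pair; congr pair; ring.
Qed.

Lemma HC_line x v s : HC (line x v s) -> locally s (fun r => HC (line x v r)).
Proof.
move=> h.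
have c : continuous (fun r => Im (fst x) + r * Im (fst v)) s.
  by apply: ex_derive_continuous; auto_derive.
have := c _ (open_gt 0 _ _).
rewrite -Im_line => /(_ h) [d hd]; exists d => r /hd.
by rewrite /HC Im_line.
Qed.

Lemma dirD_ext_HC f g v x : (forall y, HC y -> f y = g y) -> HC x ->
  dirD f v x = dirD g v x.
Proof.
move=> fg x0; rewrite -(line0 x v) in x0; have near := HC_line x0.
by congr pair; apply: Derive_ext_loc; case: near => d hd; exists d => s /hd /fg ->.
Qed.

Lemma dirD_exists_ext_HC f g v x : (forall y, HC y -> f y = g y) -> HC x ->
  dirD_exists g v x -> dirD_exists f v x.
Proof.
move=> fg x0 [e1 e2]; rewrite -(line0 x v) in x0; have [d hd] := HC_line x0.
by split; [apply: ex_derive_ext_loc e1 | apply: ex_derive_ext_loc e2];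
  exists d => s /hd /fg ->.
Qed.

(** Points of [HC] stay in [HC] for a short time along any line, so [dirD] at
    points of [HC] only sees the values on [HC]. *)
Lemma class_C_ext m f g : (forall y, HC y -> f y = g y) -> class_C m g -> class_C m f.
Proof.
elim: m f g => [|m IHm] f g fg [cg dg]; split=> //.
1,2: move=> x x0; apply: (continuous_ext_loc _ g); last exact: cg.
1,2: by have [d hd] := HC_open x0; exists d => y /hd /fg ->.
move=> v; have [e1 e2] := dg v; split.
  by move=> x x0; exact: dirD_exists_ext_HC fg x0 (e1 x x0).
by apply: IHm e2 => y y0; apply: dirD_ext_HC.
Qed.

Lemma dirD_RtoC (g : CC -> R) v x :
  dirD (fun y => RtoC (g y)) v x = RtoC (Derive (fun s => g (line x v s)) 0).
Proof. by congr pair; apply: Derive_const. Qed.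

Lemma is_derive_height_pow (K : R) (n : nat) x v : HC x ->
  is_derive (fun s => K * (/ Im (fst (line x v s))) ^ n) 0
    (- INR n * K * Im (fst v) * (/ Im (fst x)) ^ n.+1).
Proof.
rewrite /HC => x0.
apply: (is_derive_ext (fun s => K * (/ (Im (fst x) + s * Im (fst v))) ^ n)).
  by move=> s; rewrite Im_line.
auto_derive; first lra.
rewrite Rmult_0_l Rplus_0_r; case: n => [|n]; first by rewrite /=; ring.
by rewrite -pred_Sn S_INR /=; field; lra.
Qed.

Lemma dirD_height_pow (K : R) (n : nat) x v : HC x ->
  dirD (fun y => RtoC (K * (/ Im (fst y)) ^ n)) v x
  = RtoC (- INR n * K * Im (fst v) * (/ Im (fst x)) ^ n.+1).
Proof.
by move=> x0; rewrite dirD_RtoC; congr RtoC; apply/is_derive_unique/is_derive_height_pow.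
Qed.

Lemma continuous_Im1 (x : CC) : continuous (fun y : CC => Im (fst y)) x.
Proof.
apply: (continuous_comp (fun y : CC => fst y) (fun c : C => snd c)).
- exact: continuous_fst.
- exact: continuous_snd.
Qed.

Lemma continuous_RtoC (U : UniformSpace) (g : U -> R) x :
  continuous g x -> continuous (fun y => RtoC (g y)) x.
Proof.
move=> cg; apply: (@continuous_pair U R_UniformSpace R_UniformSpace g (fun _ => 0)) => //.
exact: continuous_const.
Qed.

(** A directional derivative of [K y^-n] is of the same kind, with [n + 1] in
    place of [n]. *)
Lemma class_C_height_pow m (K : R) (n : nat) :
  class_C m (fun y => RtoC (K * (/ Im (fst y)) ^ n)).
Proof.
elim: m K n => [|m IHm] K n; split=> //.
1,2: move=> x x0; apply: continuous_RtoC;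
  apply: (continuous_comp (fun y : CC => Im (fst y)) (fun h => K * (/ h) ^ n));
  first exact: continuous_Im1;
  by apply: ex_derive_continuous; auto_derive; move: x0; rewrite /HC; lra.
move=> v; split.
  move=> x x0; split; last exact: ex_derive_const.
  by exists (- INR n * K * Im (fst v) * (/ Im (fst x)) ^ n.+1); apply: is_derive_height_pow.
apply: class_C_ext (IHm (- INR n * K * Im (fst v)) n.+1) => y y0.
exact: dirD_height_pow.
Qed.

(** All the explicit forms of the proof are of this kind: a constant covector
    times a power of [1 / y].  Smoothness, reality, derivatives and invariance
    are then settled once for all of them. *)
Definition height_form k (om : form k) (n : nat) (K : ('I_k -> CC) -> R) : Prop :=
  forall x, HC x -> forall v, om x v = RtoC (K v * (/ Im (fst x)) ^ n).

Lemma smooth_height_form k (om : form k) n K : height_form om n K -> smooth_form om.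
Proof.
move=> omK v m; apply: class_C_ext (class_C_height_pow m (K v) n) => y y0.
exact: omK.
Qed.

Lemma real_height_form k (om : form k) n K : height_form om n K -> real_form om.
Proof. by move=> omK x x0 v; rewrite omK. Qed.

Lemma dirD_height_form k (om : form k) n K v u x : height_form om n K -> HC x ->
  dirD (fun y => om y v) u x
  = RtoC (- INR n * K v * Im (fst u) * (/ Im (fst x)) ^ n.+1).
Proof.
move=> omK x0; rewrite -dirD_height_pow //; apply: dirD_ext_HC => // y y0.
exact: omK.
Qed.

Definition affine_map (A B b c : R) (x : CC) : CC :=
  (RtoC A * fst x + RtoC B, snd x + RtoC b * fst x + RtoC c)%C.

Definition affine_tangent (A b : R) (v : CC) : CC :=
  (RtoC A * fst v, snd v + RtoC b * fst v)%C.

Lemma dirD_affine f v x p q : (forall s, f (line x v s) = (p + RtoC s * q)%C) ->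
  dirD f v x = q.
Proof.
move=> fE; case: p q fE => [p1 p2] [q1 q2] fE; congr pair.
- rewrite (Derive_ext _ (fun s => p1 + s * q1)); last by move=> s; rewrite fE /=; ring.
  by apply: is_derive_unique; auto_derive => //; ring.
- rewrite (Derive_ext _ (fun s => p2 + s * q2)); last by move=> s; rewrite fE /=; ring.
  by apply: is_derive_unique; auto_derive => //; ring.
Qed.

Lemma tangent_affine A B b c x v :
  tangent_map (affine_map A B b c) x v = affine_tangent A b v.
Proof.
congr pair.
- by apply: (@dirD_affine _ _ _ (RtoC A * fst x + RtoC B)) => s; rewrite /=; ring.
- by apply: (@dirD_affine _ _ _ (snd x + RtoC b * fst x + RtoC c)) => s; rewrite /=; ring.
Qed.

Lemma Im_affine A B b c x : Im (fst (affine_map A B b c x)) = A * Im (fst x).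
Proof. by case: x => [[? ?] ?]; rewrite /Im /=; ring. Qed.

Lemma phi0_affine alpha t : phi0 alpha t = affine_map alpha 0 0 t.
Proof. by apply: functional_extensionality => x; congr pair; ring. Qed.

Lemma phi12_affine a b c : phi12 a b c = affine_map 1 a b c.
Proof. by apply: functional_extensionality => x; congr pair; ring. Qed.

Lemma phi3_affine kappa : phi3 kappa = affine_map 1 0 0 kappa.
Proof. by apply: functional_extensionality => x; congr pair; ring. Qed.

(** The affine maps [(A w + B, z + b w + c)] with real coefficients and [A > 0]
    form a group that contains the four generators. *)
Lemma inoue_group_affine alpha a1 a2 b1 b2 c1 c2 r t g : 1 < alpha ->
  inoue_group alpha a1 a2 b1 b2 c1 c2 r t g ->
  exists A B b c, 0 < A /\ g = affine_map A B b c.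
Proof.
move=> alpha1; elim.
- move=> {}g [->|[->|[->|->]]].
  + by exists alpha, 0, 0, t; rewrite phi0_affine; split=> //; lra.
  + by exists 1, a1, b1, c1; rewrite phi12_affine; split=> //; lra.
  + by exists 1, a2, b2, c2; rewrite phi12_affine; split=> //; lra.
  + by exists 1, 0, 0, (inoue_kappa a1 a2 b1 b2 r); rewrite phi3_affine; split=> //; lra.
- exists 1, 0, 0, 0; split; first lra.
  by apply: functional_extensionality => -[w z]; rewrite /affine_map /=; congr pair; ring.
- move=> g1 g2 _ [A [B [b [c [A0 ->]]]]] _ [A' [B' [b' [c' [A0' ->]]]]].
  exists (A * A'), (A * B' + B), (b' + b * A'), (c' + b * B' + c).
  split; first exact: Rmult_lt_0_compat.
  by apply: functional_extensionality => x; rewrite /affine_map /= !(RtoC_plus, RtoC_mult);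
    congr pair; ring.
- move=> g1 g2 _ [A [B [b [c [A0 ->]]]]] _ K.
  have A0' : RtoC A <> 0%C by move=> /(RtoC_inj A 0); lra.
  have iA : RtoC (/ A) = (/ RtoC A)%C by apply: RtoC_inv; lra.
  exists (/ A), (- B / A), (- b / A), (b * B / A - c).
  split; first exact: Rinv_0_lt_compat.
  apply: functional_extensionality => x; move: (K x); move: (g2 x) => [w z] <-.
  rewrite /affine_map /= /Rdiv !(RtoC_plus, RtoC_minus, RtoC_mult, RtoC_opp) iA.
  congr pair; field; exact: A0'.
Qed.

Lemma tup_affine A b (s : seq CC) k : size s = k ->
  (fun i => affine_tangent A b (@tup s k i)) = @tup (map (affine_tangent A b) s) k.
Proof.
move=> sz; apply: functional_extensionality => i; rewrite /tup (nth_map (RtoC 0, RtoC 0)) //.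
by rewrite sz.
Qed.

(** The tangent map is the same at every point, and the height is multiplied
    by [A]; so invariance amounts to a homogeneity property of the constant
    covector. *)
Lemma invariant_height_form k (om : form k) n K (G : (CC -> CC) -> Prop) :
  (forall g, G g -> exists A B b c, 0 < A /\ g = affine_map A B b c) ->
  height_form om n K ->
  (forall A b v, K (fun i => affine_tangent A b (v i)) = A ^ n * K v) ->
  Defs.invariant G om.
Proof.
move=> Gaff omK Kinv g /Gaff[A [B [b [c [A0 ->]]]]] x x0 v.
have x0' : HC (affine_map A B b c x) by rewrite /HC Im_affine; apply: Rmult_lt_0_compat.
rewrite /pullback (omK _ x0') (omK _ x0) Im_affine; congr RtoC.
have -> : (fun i => tangent_map (affine_map A B b c) x (v i))
    = (fun i => affine_tangent A b (v i)).
  by apply: functional_extensionality => i; rewrite tangent_affine.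
rewrite Kinv Rinv_mult Rpow_mult_distr (pow_inv A); set h := (/ Im _) ^ n.
have An : A ^ n <> 0 by apply: pow_nonzero; lra.
by field.
Qed.

(** * The two cocycles and a primitive of the first *)

(** The exterior product of [dx], [dy] and [m]. *)
Definition det_dw_l (m : CC -> R) (v0 v1 v2 : CC) : R :=
  Re (fst v0) * (Im (fst v1) * m v2 - Im (fst v2) * m v1)
  - Re (fst v1) * (Im (fst v0) * m v2 - Im (fst v2) * m v0)
  + Re (fst v2) * (Im (fst v0) * m v1 - Im (fst v1) * m v0).

Lemma theta1_HC x v : HC x -> theta1 x v = (RtoC (/ Im (fst x)) * fst v)%C.
Proof.
rewrite /HC => x0; rewrite /theta1 /Cdiv RtoC_inv; last by lra.
by ring.
Qed.

Lemma theta1_bar_HC x v : HC x ->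
  theta1_bar x v = (RtoC (/ Im (fst x)) * Cconj (fst v))%C.
Proof.
move=> x0; rewrite /theta1_bar theta1_HC // Cmult_conj; congr (_ * _)%C.
by rewrite /Cconj /RtoC /= Ropp_0.
Qed.

Lemma i_theta_tup (m : CC -> R) x u0 u1 u2 : HC x ->
  i_theta1_theta1bar_wedge (fun v => RtoC (m v)) x (@tup [:: u0; u1; u2] 3)
  = RtoC (2 * det_dw_l m u0 u1 u2 * (/ Im (fst x)) ^ 2).
Proof.
move=> x0; rewrite /i_theta1_theta1bar_wedge wedge_tup3 !wedge_tup2 !theta1_HC // !theta1_bar_HC //.
rewrite /cov1 /tup /= /det_dw_l.
move: (/ Im (fst x)) (m u0) (m u1) (m u2) => y m0 m1 m2.
case: u0 u1 u2 => [[? ?] ?] [[? ?] ?] [[? ?] ?].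
by rewrite /Ci /Cconj /RtoC /Cmult /Cplus /Cminus /Cplus /Copp /Re /Im /=; congr pair; ring.
Qed.

Definition det_dw_l_cov (m : CC -> R) (v : 'I_3 -> CC) : R :=
  2 * det_dw_l m (v (@Ordinal 3 0 isT)) (v (@Ordinal 3 1 isT)) (v (@Ordinal 3 2 isT)).

Lemma height_form_i_theta (m : CC -> R) :
  height_form (i_theta1_theta1bar_wedge (fun v => RtoC (m v))) 2 (det_dw_l_cov m).
Proof.
by move=> x x0 v; have [u0 [u1 [u2 ->]]] := tup3_eta v; rewrite i_theta_tup.
Qed.

(** The two parts come from the [dz] and the [dz^*] component of [l]. *)
Lemma form21_12_i_theta (lam mu : C) (l : CC -> C) :
  (forall u, l u = (lam * snd u + mu * Cconj (snd u))%C) ->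
  form21_12 (i_theta1_theta1bar_wedge l).
Proof.
move=> lE x x0.
pose y := RtoC (/ Im (fst x)).
exists (wedge (fun u => (Ci * y * fst u + RtoC 0 * snd u)%C)
  (wedge (fun u => (y * Cconj (fst u) + RtoC 0 * Cconj (snd u))%C)
    (wedge (fun u => (RtoC 0 * fst u + lam * snd u)%C) (fun _ => RtoC 1)))).
exists (wedge (fun u => (Ci * y * fst u + RtoC 0 * snd u)%C)
  (wedge (fun u => (y * Cconj (fst u) + RtoC 0 * Cconj (snd u))%C)
    (wedge (fun u => (RtoC 0 * Cconj (fst u) + mu * Cconj (snd u))%C) (fun _ => RtoC 1)))).
split; first by do ?[exact: bidegree_cst | apply: bidegree_10 | apply: bidegree_01].
split; first by do ?[exact: bidegree_cst | apply: bidegree_10 | apply: bidegree_01].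
move=> v; have [u0 [u1 [u2 ->]]] := tup3_eta v.
rewrite /i_theta1_theta1bar_wedge !wedge_tup3 !wedge_tup2 !wedge_tup1.
rewrite !theta1_HC // !theta1_bar_HC // -/y /cov1 !lE /tup /=.
by ring.
Qed.

(** Both [d] and [eta /\ _] produce a second factor [dy]. *)
Lemma d_eta_i_theta (m : CC -> R) x v : HC x ->
  d_eta (i_theta1_theta1bar_wedge (fun v => RtoC (m v))) x v = RtoC 0.
Proof.
move=> x0; have [u0 [u1 [u2 [u3 ->]]]] := tup4_eta v.
have hf := height_form_i_theta m.
rewrite /d_eta ext_d_tup4 wedge_tup4 !(dirD_height_form _ _ hf x0) !(hf x x0).
rewrite /eta /det_dw_l_cov /tup /= /det_dw_l /Rdiv.
move: (/ Im (fst x)) (m u0) (m u1) (m u2) (m u3) => y m0 m1 m2 m3.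
case: u0 u1 u2 u3 => [[? ?] ?] [[? ?] ?] [[? ?] ?] [[? ?] ?].
by rewrite /RtoC /Cmult /Cplus /Cminus /Cplus /Copp /Re /Im /=; congr pair; ring.
Qed.

(** The tangent map adds to [m] a combination of [dx] and [dy], which is killed
    by the factor [dx /\ dy]. *)
Lemma cocycle_i_theta (G : (CC -> CC) -> Prop) (lam mu : C) (p q : R) (m : CC -> R) :
  (forall g, G g -> exists A B b c, 0 < A /\ g = affine_map A B b c) ->
  (forall u, RtoC (m u) = (lam * snd u + mu * Cconj (snd u))%C) ->
  (forall A b u, m (affine_tangent A b u)
     = m u + b * (p * Re (fst u) + q * Im (fst u))) ->
  cocycle G (i_theta1_theta1bar_wedge (fun v => RtoC (m v))).
Proof.
move=> Gaff mE minv; have hf := height_form_i_theta m.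
split; last by move=> x x0 v; exact: d_eta_i_theta.
split; first exact: smooth_height_form hf.
split; first exact: real_height_form hf.
split; first exact: (form21_12_i_theta mE).
apply: (invariant_height_form Gaff hf) => A b v.
rewrite /det_dw_l_cov /det_dw_l !minv.
move: (v _) (v _) (v _) => [[? ?] ?] [[? ?] ?] [[? ?] ?].
by rewrite /affine_tangent /Re /Im /=; ring.
Qed.

Lemma cocycle_dz1 G :
  (forall g, G g -> exists A B b c, 0 < A /\ g = affine_map A B b c) ->
  cocycle G (i_theta1_theta1bar_wedge dz1).
Proof.
move=> Gaff.
apply: (@cocycle_i_theta G (RtoC (/ 2)) (RtoC (/ 2)) 1 0 (fun v => Re (snd v)) Gaff).
- by move=> [? [? ?]]; rewrite /RtoC /Cmult /Cplus /Cconj /Re /=; congr pair; field.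
- by move=> A b [[? ?] [? ?]]; rewrite /affine_tangent /Re /Im /=; ring.
Qed.

Lemma cocycle_dz2 G :
  (forall g, G g -> exists A B b c, 0 < A /\ g = affine_map A B b c) ->
  cocycle G (i_theta1_theta1bar_wedge dz2).
Proof.
move=> Gaff.
apply: (@cocycle_i_theta G (- Ci / RtoC 2)%C (Ci / RtoC 2)%C 0 1 (fun v => Im (snd v)) Gaff).
- move=> [? [? ?]]; rewrite /Ci /RtoC /Cdiv /Cinv /Cmult /Cplus /Copp /Cconj /Im /=.
  by congr pair; field.
- by move=> A b [[? ?] [? ?]]; rewrite /affine_tangent /Re /Im /=; ring.
Qed.

(** The real part of [dw /\ dz^*]. *)
Definition re_dw_dzbar (u v : CC) : R :=
  Re (fst u) * Re (snd v) - Re (fst v) * Re (snd u)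
  + (Im (fst u) * Im (snd v) - Im (fst v) * Im (snd u)).

(** Half the sum of [y^-1 dw /\ dz^*] and its conjugate, written in the shape
    required by [bidegree]. *)
Definition primitive_dz1 : form 2 := fun x v =>
  (wedge (fun u => (RtoC (/ 2 * / Im (fst x)) * fst u + RtoC 0 * snd u))
    (wedge (fun u => RtoC 0 * Cconj (fst u) + RtoC 1 * Cconj (snd u)) (fun _ => RtoC 1)) v
  + wedge (fun u => (RtoC 0 * fst u + RtoC (- / 2 * / Im (fst x)) * snd u))
    (wedge (fun u => RtoC 1 * Cconj (fst u) + RtoC 0 * Cconj (snd u)) (fun _ => RtoC 1)) v)%C.

Definition re_dw_dzbar_cov (v : 'I_2 -> CC) : R :=
  re_dw_dzbar (v (@Ordinal 2 0 isT)) (v (@Ordinal 2 1 isT)).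

Lemma height_form_primitive : height_form primitive_dz1 1 re_dw_dzbar_cov.
Proof.
move=> x _ v; have [u0 [u1 ->]] := tup2_eta v.
rewrite /primitive_dz1 !wedge_tup2 !wedge_tup1 /re_dw_dzbar_cov /tup /= /re_dw_dzbar.
move: (/ Im (fst x)) => y; case: u0 u1 => [[? ?] [? ?]] [[? ?] [? ?]].
by rewrite /RtoC /Cconj /Cmult /Cplus /Cminus /Cplus /Copp /Re /Im /=; congr pair; field.
Qed.

Lemma real11_primitive G :
  (forall g, G g -> exists A B b c, 0 < A /\ g = affine_map A B b c) ->
  real11 G primitive_dz1.
Proof.
move=> Gaff; have hf := height_form_primitive.
split; first exact: smooth_height_form hf.
split; first exact: real_height_form hf.
split.
  move=> x x0; apply: bidegree_add;
    by do ?[exact: bidegree_cst | apply: bidegree_10 | apply: bidegree_01].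
apply: (invariant_height_form Gaff hf) => A b v.
rewrite /re_dw_dzbar_cov /re_dw_dzbar.
move: (v _) (v _) => [[? ?] [? ?]] [[? ?] [? ?]].
by rewrite /affine_tangent /Re /Im /=; ring.
Qed.

Lemma d_eta_primitive : eq_form (i_theta1_theta1bar_wedge dz1) (d_eta primitive_dz1).
Proof.
move=> x x0 v; have [u0 [u1 [u2 ->]]] := tup3_eta v.
have hf := height_form_primitive.
rewrite (i_theta_tup (fun v => Re (snd v))) //.
rewrite /d_eta ext_d_tup3 wedge_tup3 !(dirD_height_form _ _ hf x0) !(hf x x0).
rewrite /eta /re_dw_dzbar_cov /tup /= /re_dw_dzbar /det_dw_l /Rdiv.
move: (/ Im (fst x)) => y.
case: u0 u1 u2 => [[? ?] [? ?]] [[? ?] [? ?]] [[? ?] [? ?]].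
by rewrite /RtoC /Cmult /Cplus /Cminus /Cplus /Copp /Re /Im /=; congr pair; ring.
Qed.

(** * Coordinates of forms of type (1,1) *)

(** An induction on [bidegree] goes through covectors of lower degree; this
    records what is needed in degrees 0 and 1 to expand a covector of type
    (1,1) in degree 2. *)
Definition bidegree_spec (k p q : nat) : cov k -> Prop :=
  match k with
  | 0%N => fun tau => exists c, forall v, tau v = c
  | 1%N => fun tau =>
      (p = 1%N -> q = 0%N -> exists a b, forall u,
         tau (@tup [:: u] 1) = (a * fst u + b * snd u)%C) /\
      (p = 0%N -> q = 1%N -> exists a b, forall u,
         tau (@tup [:: u] 1) = (a * Cconj (fst u) + b * Cconj (snd u))%C)
  | 2%N => fun tau => p = 1%N -> q = 1%N -> exists a b c d, forall u v,
      tau (@tup [:: u; v] 2) =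
        (a * (fst u * Cconj (fst v) - fst v * Cconj (fst u))
         + b * (fst u * Cconj (snd v) - fst v * Cconj (snd u))
         + c * (snd u * Cconj (fst v) - snd v * Cconj (fst u))
         + d * (snd u * Cconj (snd v) - snd v * Cconj (snd u)))%C
  | _ => fun _ => True
  end.

(** The product rule for [wedge] determines each case from the previous
    degree. *)
Lemma bidegreeP k p q (tau : cov k) : bidegree p q tau -> bidegree_spec p q tau.
Proof.
elim=> {k p q tau}.
- by move=> c; exists c.
- move=> a b [|[|k]] p q tau _ //=.
  + case=> c tauE; split=> // _ _; exists (a * c)%C, (b * c)%C => u.
    by rewrite wedge_tup1 tauE; ring.
  + case=> _ tau01 [p0] q1; have [c [d tauE]] := tau01 p0 q1.
    exists (a * c)%C, (a * d)%C, (b * c)%C, (b * d)%C => u v.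
    by rewrite wedge_tup2 !tauE; ring.
- move=> a b [|[|k]] p q tau _ //=.
  + case=> c tauE; split=> // _ _; exists (a * c)%C, (b * c)%C => u.
    by rewrite wedge_tup1 tauE; ring.
  + case=> tau10 _ p1 [q0]; have [c [d tauE]] := tau10 p1 q0.
    exists (- (a * c))%C, (- (b * c))%C, (- (a * d))%C, (- (b * d))%C => u v.
    by rewrite wedge_tup2 !tauE; ring.
- move=> [|[|[|k]]] p q tau tau' _ + _ //=.
  + by move=> [c tE] [c' tE']; exists (c + c')%C => v; rewrite tE tE'.
  + move=> [h10 h01] [h10' h01']; split=> p0 q0.
    * have [a [b tE]] := h10 p0 q0; have [a' [b' tE']] := h10' p0 q0.
      by exists (a + a')%C, (b + b')%C => u; rewrite tE tE'; ring.
    * have [a [b tE]] := h01 p0 q0; have [a' [b' tE']] := h01' p0 q0.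
      by exists (a + a')%C, (b + b')%C => u; rewrite tE tE'; ring.
  + move=> h h' p1 q1; have [a [b [c [d tE]]]] := h p1 q1.
    have [a' [b' [c' [d' tE']]]] := h' p1 q1.
    by exists (a + a')%C, (b + b')%C, (c + c')%C, (d + d')%C => u v; rewrite tE tE'; ring.
Qed.

Definition e_x : CC := (RtoC 1, RtoC 0).
Definition e_y : CC := (Ci, RtoC 0).
Definition e_1 : CC := (RtoC 0, RtoC 1).
Definition e_2 : CC := (RtoC 0, Ci).

Definition re_at (om : form 2) (u v : CC) (x : CC) : R := Re (om x (@tup [:: u; v] 2)).

(** Besides being alternating and bilinear, a covector of type (1,1) is
    invariant under multiplication of both arguments by [i]; this identifies
    two pairs among its six coordinates, up to sign. *)
Lemma form11_coordinates (om : form 2) x u v : form11 om -> HC x ->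
  re_at om u v x =
    re_at om e_x e_y x * (Re (fst u) * Im (fst v) - Re (fst v) * Im (fst u))
  + re_at om e_1 e_2 x * (Re (snd u) * Im (snd v) - Re (snd v) * Im (snd u))
  + re_at om e_y e_2 x * (Re (fst u) * Re (snd v) - Re (fst v) * Re (snd u)
                          + Im (fst u) * Im (snd v) - Im (fst v) * Im (snd u))
  + re_at om e_x e_2 x * (Re (fst u) * Im (snd v) - Re (fst v) * Im (snd u)
                          - Im (fst u) * Re (snd v) + Im (fst v) * Re (snd u)).
Proof.
move=> om11 x0; have [a [b [c [d E]]]] := bidegreeP (om11 x x0) erefl erefl.
rewrite /re_at !E /e_x /e_y /e_1 /e_2.
case: a b c d u v {E} => [? ?] [? ?] [? ?] [? ?] [[? ?] [? ?]] [[? ?] [? ?]].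
by rewrite /Ci /RtoC /Cconj /Cmult /Cplus /Cminus /Cplus /Copp /Re /Im /=; ring.
Qed.

(** * Invariant continuous functions are bounded *)

Lemma compact_bound (f : CC -> R) (K : R) : (forall x, HC x -> continuous f x) ->
  exists M, forall x, Rabs (Re (fst x)) <= K -> 1 <= Im (fst x) <= K ->
    Rabs (Re (snd x)) <= K -> Rabs (Im (snd x)) <= K -> Rabs (f x) <= M.
Proof.
move=> cf.
pose pt (q : Compactness.Tn 4 R) : CC :=
  let '(x, (y, (z1, (z2, _)))) := q in ((x, y), (z1, z2)).
have ex_d q : exists d : posreal, HC (pt q) ->
    forall p, ball (pt q) d p -> Rabs (f p - f (pt q)) < 1.
  case: (excluded_middle_informative (HC (pt q))) => hq; last first.
    by exists (mkposreal _ Rlt_0_1).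
  have [d hd] := proj1 (filterlim_locally _ _) (cf _ hq) (mkposreal _ Rlt_0_1).
  by exists d => _ p hp; exact: hd.
pose delta q := proj1_sig (constructive_indefinite_description _ (ex_d q)).
have hdelta q := proj2_sig (constructive_indefinite_description _ (ex_d q)).
apply: NNPP => hn.
apply: (@compactness_list 4 (- K, (1, (- K, (- K, tt)))) (K, (K, (K, (K, tt)))) delta).
move=> [l hl]; apply: hn.
have [M hM] : exists M, forall q, List.In q l -> Rabs (f (pt q)) + 1 <= M.
  elim: l {hl} => [|q l [M hM]]; first by exists 0.
  exists (Rmax M (Rabs (f (pt q)) + 1)) => q' /= [<-|h]; first exact: Rmax_r.
  by apply: Rle_trans (hM _ h) (Rmax_l _ _).
exists M => -[[x y] [z1 z2]] /= /Rabs_le_between hx hy /Rabs_le_between h1 /Rabs_le_between h2.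
have [|q [ql [qb qc]]] := hl (x, (y, (z1, (z2, tt)))); first by [].
apply: Rle_trans (hM _ ql).
case: q ql qb qc => [x' [y' [z1' [z2' []]]]] ql [bx [b_y [b1 [b2 _]]]] [cx [c_y [c1 [c2 _]]]].
have hq : HC (pt (x', (y', (z1', (z2', tt))))) by rewrite /HC /=; lra.
have := hdelta _ hq ((x, y), (z1, z2)); rewrite -/(delta _).
move=> /(_ (conj (conj cx c_y) (conj c1 c2))).
by move: (f _) (f (pt _)) => r1 r2; rewrite /Rabs; do 3 case: Rcase_abs; lra.
Qed.

(** Each generator is the time-one map of a one-parameter group, so its
    integer powers, negative ones included, are the integer times of the
    flow. *)
Lemma invariant_flow (T : Type) (D : T -> Prop) (f : T -> R) (act : R -> T -> T) :
  (forall x, act 0 x = x) -> (forall u v x, act (u + v) x = act u (act v x)) ->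
  (forall u x, D x -> D (act u x)) -> (forall x, D x -> f (act 1 x) = f x) ->
  forall (n : Z) x, D x -> f (act (IZR n) x) = f x.
Proof.
move=> act0 actD actP act1.
have nat_case (n : nat) : forall x, D x -> f (act (INR n) x) = f x.
  elim: n => [|n IHn] x Dx; first by rewrite /= act0.
  by rewrite S_INR Rplus_comm actD act1 ?IHn //; apply: actP.
move=> n x Dx; case: (Z_le_gt_dec 0 n) => n0.
  by rewrite -(Z2Nat.id n) // -INR_IZR_INZ; exact: nat_case.
have -> : IZR n = - INR (Z.to_nat (- n)).
  by rewrite INR_IZR_INZ Z2Nat.id ?opp_IZR; [ring | lia].
rewrite -(nat_case (Z.to_nat (- n))); last exact: actP.
by rewrite -actD Rplus_opp_r act0.
Qed.

Lemma integer_translate_unit (u : R) : exists n : Z, 0 <= u + IZR n <= 1.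
Proof.
exists (1 - up u)%Z; rewrite minus_IZR; have := archimed u; lra.
Qed.

Definition flow0 (alpha t u : R) (x : CC) : CC :=
  (RtoC (exp (u * ln alpha)) * fst x, snd x + RtoC (u * t))%C.

(** The quadratic term accounts for the shear: [w] moves while [z] is being
    translated by a multiple of [w]. *)
Definition flow12 (a b c u : R) (x : CC) : CC :=
  (fst x + RtoC (u * a), snd x + RtoC (u * b) * fst x
     + RtoC (u * (u - 1) / 2 * (a * b) + u * c))%C.

Lemma invariant_flow0 (f : CC -> R) alpha t : 1 < alpha ->
  (forall x, HC x -> f (phi0 alpha t x) = f x) ->
  forall (n : Z) x, HC x -> f (flow0 alpha t (IZR n) x) = f x.
Proof.
move=> alpha1 finv.
have E : flow0 alpha t 1 = phi0 alpha t.
  by apply: functional_extensionality => x; rewrite /flow0 !Rmult_1_l exp_ln //; lra.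
apply: invariant_flow; rewrite ?E //.
- by move=> [w z]; rewrite /flow0 !Rmult_0_l exp_0 /=; congr pair; ring.
- by move=> u v [w z]; rewrite /flow0 /= !Rmult_plus_distr_r exp_plus RtoC_mult RtoC_plus;
    congr pair; ring.
- move=> u [[x y] z]; rewrite /HC /flow0 /Im /= => y0.
  by rewrite Rmult_0_l Rplus_0_r; apply: Rmult_lt_0_compat => //; exact: exp_pos.
Qed.

Lemma invariant_flow12 (f : CC -> R) a b c :
  (forall x, HC x -> f (phi12 a b c x) = f x) ->
  forall (n : Z) x, HC x -> f (flow12 a b c (IZR n) x) = f x.
Proof.
move=> finv.
have E : flow12 a b c 1 = phi12 a b c.
  apply: functional_extensionality => x; rewrite /flow12 /phi12 !Rmult_1_l.
  by congr (_, (_ + RtoC _)%C); field.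
apply: invariant_flow; rewrite ?E //.
- move=> [w z]; rewrite /flow12 !Rmult_0_l /Rdiv !Rmult_0_l Rplus_0_l /=; congr pair; ring.
- move=> u v [w z]; rewrite /flow12 /=.
  have -> : (u + v) * (u + v - 1) / 2 * (a * b) + (u + v) * c
    = (v * (v - 1) / 2 * (a * b) + v * c) + (u * (u - 1) / 2 * (a * b) + u * c)
      + u * b * (v * a) by field.
  by rewrite !Rmult_plus_distr_r !RtoC_plus !(RtoC_mult (u * b) (v * a)); congr pair; ring.
- by move=> u [[x y] z]; rewrite /HC /flow12 /Im /= Rplus_0_r.
Qed.

Lemma flow12_coords a b c u x y z1 z2 : exists z1',
  flow12 a b c u ((x, y), (z1, z2)) = ((x + u * a, y), (z1', z2 + u * b * y)).
Proof.
exists (z1 + u * b * x + (u * (u - 1) / 2 * (a * b) + u * c)).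
by rewrite /flow12 /RtoC /Cplus /Cmult /=; congr pair; congr pair; ring.
Qed.

Lemma Rabs_unit_combination u v p q :
  0 <= u <= 1 -> 0 <= v <= 1 -> Rabs (u * p + v * q) <= Rabs p + Rabs q.
Proof.
move=> hu hv; apply: Rle_trans (Rabs_triang _ _) _; rewrite !Rabs_mult.
rewrite (Rabs_pos_eq u) ?(Rabs_pos_eq v); try lra.
have := Rabs_pos p; have := Rabs_pos q; nra.
Qed.

(** The action is cocompact.  Powers of [phi0] bring the height into
    [1, alpha].  The maps [phi12] translate [(x, z2 / y)] by the vectors
    [(a_i, b_i)], which span a lattice of the plane, and [phi3] translates
    [z1].  So every point can be moved into a fixed compact set. *)
Lemma bounded_of_invariant (f : CC -> R) alpha t a1 a2 b1 b2 c1 c2 kappa :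
  1 < alpha -> a1 * b2 - a2 * b1 <> 0 -> kappa <> 0 ->
  (forall x, HC x -> continuous f x) ->
  (forall x, HC x -> f (phi0 alpha t x) = f x) ->
  (forall x, HC x -> f (phi12 a1 b1 c1 x) = f x) ->
  (forall x, HC x -> f (phi12 a2 b2 c2 x) = f x) ->
  (forall x, HC x -> f (phi3 kappa x) = f x) ->
  exists M, forall x, HC x -> Rabs (f x) <= M.
Proof.
move=> alpha1 det0 kappa0 cf f0 f1 f2 f3.
pose K := alpha + (Rabs a1 + Rabs a2) + alpha * (Rabs b1 + Rabs b2) + Rabs kappa.
have [M hM] := compact_bound K cf.
exists M => -[[x y] z] x0.
have lna : 0 < ln alpha by rewrite -ln_1; apply: ln_increasing; lra.
have y0 : 0 < y := x0.
(* scale the height into [1, alpha] *)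
have [n hn] := integer_translate_unit (ln y / ln alpha).
rewrite -(invariant_flow0 alpha1 f0 n) //; set p := flow0 _ _ _ _.
have hp : 1 <= Im (fst p) <= alpha.
  have -> : Im (fst p) = exp ((ln y / ln alpha + IZR n) * ln alpha).
    rewrite /p /flow0 /Im /= Rmult_0_l Rplus_0_r.
    have -> : (ln y / ln alpha + IZR n) * ln alpha = IZR n * ln alpha + ln y by field; lra.
    by rewrite exp_plus exp_ln.
  have le_exp u v : u <= v -> exp u <= exp v.
    by case=> [h|->]; [apply: Rlt_le; apply: exp_increasing | lra].
  split; first by rewrite -exp_0; apply: le_exp; nra.
  by rewrite -[X in _ <= X](exp_ln alpha); [apply: le_exp; nra | lra].
case: p hp => [[{x0 y0 hn n}x y'] [z1 z2]]; rewrite {1 2}/Im /= => hy.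
have y0 : 0 < y' by lra.
(* translate (x, z2 / y) into the fundamental parallelogram *)
pose s := z2 / y'; pose D := a1 * b2 - a2 * b1.
have [n hn] := integer_translate_unit ((x * b2 - s * a2) / D).
have [m hm] := integer_translate_unit ((a1 * s - b1 * x) / D).
rewrite -(invariant_flow12 f1 n) //.
have [z1' ->] := flow12_coords a1 b1 c1 (IZR n) x y' z1 z2.
rewrite -(invariant_flow12 f2 m) //.
have [z1'' ->] := flow12_coords a2 b2 c2 (IZR m) (x + IZR n * a1) y' z1' (z2 + IZR n * b1 * y').
have -> : x + IZR n * a1 + IZR m * a2
    = ((x * b2 - s * a2) / D + IZR n) * a1 + ((a1 * s - b1 * x) / D + IZR m) * a2.
  by rewrite /D; field.
have -> : z2 + IZR n * b1 * y' + IZR m * b2 * y'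
    = y' * (((x * b2 - s * a2) / D + IZR n) * b1 + ((a1 * s - b1 * x) / D + IZR m) * b2).
  by rewrite /D /s; field; lra.
(* translate z1 into a period *)
have [k hk] := integer_translate_unit (z1'' / kappa).
have f3' q : HC q -> f (phi12 0 0 kappa q) = f q.
  move=> hq; rewrite -(f3 q hq); congr f.
  by case: q {hq} => w z'; rewrite /phi12 /phi3 /=; congr pair; ring.
rewrite -(invariant_flow12 f3' k) //.
set q1 := _ + _ * a2; set q2 := y' * _.
have -> : flow12 0 0 kappa (IZR k) ((q1, y'), (z1'', q2))
    = ((q1, y'), ((z1'' / kappa + IZR k) * kappa, q2)).
  by rewrite /flow12 /RtoC /Cplus /Cmult /=; congr pair; congr pair; field.
have pa := Rabs_pos a1; have pa2 := Rabs_pos a2; have pb := Rabs_pos b1.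
have pb2 := Rabs_pos b2; have pk := Rabs_pos kappa.
have pab : 0 <= alpha * (Rabs b1 + Rabs b2) by apply: Rmult_le_pos; lra.
apply: hM; rewrite /Re /Im /=.
- apply: Rle_trans (Rabs_unit_combination a1 a2 hn hm) _; rewrite /K; lra.
- rewrite /K; lra.
- rewrite Rabs_mult (Rabs_pos_eq (_ + _)); last lra.
  have : (z1'' / kappa + IZR k) * Rabs kappa <= 1 * Rabs kappa.
    by apply: Rmult_le_compat_r; lra.
  rewrite /K; lra.
- rewrite /q2 Rabs_mult (Rabs_pos_eq y'); last lra.
  have h := Rabs_unit_combination b1 b2 hn hm.
  have : y' * Rabs (((x * b2 - s * a2) / D + IZR n) * b1 + ((a1 * s - b1 * x) / D + IZR m) * b2)
    <= alpha * (Rabs b1 + Rabs b2).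
    by apply: Rmult_le_compat => //; [lra | exact: Rabs_pos | lra].
  rewrite /K; lra.
Qed.

(** Eliminating the matrix entries between two equations multiplies each of the
    products [a_i b_j] by [lam - mu]. *)
Lemma eigenvectors_independent (m11 m12 m21 m22 lam mu a1 a2 b1 b2 : R) :
  lam <> mu -> (a1, a2) <> (0, 0) -> (b1, b2) <> (0, 0) ->
  m11 * a1 + m12 * a2 = lam * a1 -> m21 * a1 + m22 * a2 = lam * a2 ->
  m11 * b1 + m12 * b2 = mu * b1 -> m21 * b1 + m22 * b2 = mu * b2 ->
  a1 * b2 - a2 * b1 <> 0.
Proof.
move=> lm ha hb e1 e2 e3 e4 D.
have lm0 : lam - mu <> 0 by lra.
have cancel r : (lam - mu) * r = 0 -> r = 0 by case/Rmult_integral.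
have p11 : a1 * b1 = 0.
  apply: cancel; rewrite Rmult_minus_distr_r -Rmult_assoc -e1.
  have -> : mu * (a1 * b1) = a1 * (mu * b1) by ring.
  by rewrite -e3; have : m12 * (a1 * b2 - a2 * b1) = 0 by [rewrite D; ring]; lra.
have p22 : a2 * b2 = 0.
  apply: cancel; rewrite Rmult_minus_distr_r -Rmult_assoc -e2.
  have -> : mu * (a2 * b2) = a2 * (mu * b2) by ring.
  by rewrite -e4; have : m21 * (a1 * b2 - a2 * b1) = 0 by [rewrite D; ring]; lra.
have p12 : a1 * b2 = 0.
  apply: cancel; rewrite Rmult_minus_distr_r -Rmult_assoc -e1.
  have -> : mu * (a1 * b2) = a2 * (mu * b1) by rewrite (_ : a1 * b2 = a2 * b1); [ring | lra].
  by rewrite -e3; have : m11 * (a1 * b2 - a2 * b1) = 0 by [rewrite D; ring]; lra.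
have p21 : a2 * b1 = 0 by lra.
case: (Req_dec a1 0) => [a10|a1n]; last first.
  apply: hb; congr pair; [case/Rmult_integral: p11 | case/Rmult_integral: p12] => //; lra.
case: (Req_dec a2 0) => [a20|a2n]; first by apply: ha; rewrite a10 a20.
apply: hb; congr pair; [case/Rmult_integral: p21 | case/Rmult_integral: p22] => //; lra.
Qed.

(** * Derivatives of the coordinates of a primitive *)

Definition deriv (f : CC -> R) (v x : CC) : R := Derive (fun r => f (line x v r)) 0.

Definition C1_on_HC (f : CC -> R) : Prop :=
  (forall x, HC x -> continuous f x) /\
  forall v, (forall x, HC x -> ex_derive (fun r => f (line x v r)) 0) /\
            (forall x, HC x -> continuous (deriv f v) x).

Lemma C1_re_at (om : form 2) u v : smooth_form om -> C1_on_HC (re_at om u v).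
Proof.
have cRe (g : CC -> C) x : continuous g x -> continuous (fun y => Re (g y)) x.
  by move=> cg; apply: (continuous_comp g (fun c : C => fst c)) => //; exact: continuous_fst.
move=> /(_ (@tup [:: u; v] 2) 1%N)[c d]; split; first by move=> x x0; exact: (cRe _ _ (c x x0)).
move=> w; have [e [c' _]] := d w; split; first by move=> x /e[].
by move=> x x0; exact: (cRe _ _ (c' x x0)).
Qed.

(** Directional derivatives at points of a line are derivatives along the
    line, up to the speed [k]. *)
Lemma is_derive_affine_path f v (gam : R -> CC) (u k : R) : C1_on_HC f -> HC (gam u) ->
  (forall r, gam r = line (gam u) v (k * (r - u))) ->
  is_derive (fun r => f (gam r)) u (k * deriv f v (gam u)).
Proof.
move=> [_ /(_ v)[d _]] x0 gamE.
apply: (is_derive_ext (fun r => f (line (gam u) v (k * (r - u))))).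
  by move=> r; rewrite -gamE.
apply: (is_derive_comp (fun s => f (line (gam u) v s)) (fun r => k * (r - u))).
- rewrite Rminus_diag Rmult_0_r; exact: Derive_correct (d _ x0).
- by auto_derive => //; ring.
Qed.

Lemma deriv_ext_HC f g v x : (forall y, HC y -> f y = g y) -> HC x ->
  deriv f v x = deriv g v x.
Proof.
move=> fg x0; rewrite -(line0 x v) in x0; have [d hd] := HC_line x0.
by apply: Derive_ext_loc; exists d => s /hd /fg.
Qed.

Lemma deriv_combination (f1 f2 f3 f4 : CC -> R) (k1 k2 k3 k4 : R) v x : HC x ->
  C1_on_HC f1 -> C1_on_HC f2 -> C1_on_HC f3 -> C1_on_HC f4 ->
  deriv (fun y => f1 y * k1 + f2 y * k2 + f3 y * k3 + f4 y * k4) v x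
  = deriv f1 v x * k1 + deriv f2 v x * k2 + deriv f3 v x * k3 + deriv f4 v x * k4.
Proof.
move=> x0 [_ /(_ v)[d1 _]] [_ /(_ v)[d2 _]] [_ /(_ v)[d3 _]] [_ /(_ v)[d4 _]].
apply: is_derive_unique.
do 3?[apply: (@is_derive_plus R_AbsRing R_NormedModule)];
  apply: is_derive_scal_l; apply: Derive_correct; auto.
Qed.

(** The vectors [d/dx + s d/dz1] and [d/dy + s d/dz2] below have constant
    coefficients; they are proportional to the invariant frame only at the
    points where [z2 / y = s]. *)
Definition shear_x (s : R) : CC := (RtoC 1, RtoC s).
Definition shear_y (s : R) : CC := (Ci, (RtoC s * Ci)%C).

(** The equation for [d_eta beta] evaluated on [shear_x s], [shear_y s] and
    [d/dz2], on which [dx /\ dy /\ dz2] takes the value 1. *)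
Lemma primitive_of_dz2_equation (beta : form 2) (s : R) x :
  smooth_form beta -> form11 beta ->
  eq_form (i_theta1_theta1bar_wedge dz2) (d_eta beta) -> HC x ->
  deriv (re_at beta e_y e_2) (shear_x s) x
  - (deriv (re_at beta e_x e_2) (shear_y s) x + s * deriv (re_at beta e_1 e_2) (shear_y s) x)
  + (deriv (re_at beta e_x e_y) e_2 x + 2 * s * deriv (re_at beta e_x e_2) e_2 x
     + s ^ 2 * deriv (re_at beta e_1 e_2) e_2 x)
  + (re_at beta e_x e_2 x + s * re_at beta e_1 e_2 x) / Im (fst x)
  = 2 / Im (fst x) ^ 2.
Proof.
move=> sm b11 eqb x0.
have C1 u v := C1_re_at u v sm.
have coord u v w : deriv (re_at beta u v) w x =
    deriv (re_at beta e_x e_y) w x * (Re (fst u) * Im (fst v) - Re (fst v) * Im (fst u))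
  + deriv (re_at beta e_1 e_2) w x * (Re (snd u) * Im (snd v) - Re (snd v) * Im (snd u))
  + deriv (re_at beta e_y e_2) w x * (Re (fst u) * Re (snd v) - Re (fst v) * Re (snd u)
                          + Im (fst u) * Im (snd v) - Im (fst v) * Im (snd u))
  + deriv (re_at beta e_x e_2) w x * (Re (fst u) * Im (snd v) - Re (fst v) * Im (snd u)
                          - Im (fst u) * Re (snd v) + Im (fst v) * Re (snd u)).
  rewrite -deriv_combination //; apply: deriv_ext_HC => // y y0.
  exact: form11_coordinates.
have E := f_equal Re (eqb x x0 (@tup [:: shear_x s; shear_y s; e_2] 3)).
rewrite (i_theta_tup (fun v => Im (snd v))) // in E.
rewrite /d_eta ext_d_tup3 wedge_tup3 in E.
have ReE (A B C0 D E0 F : C) (h1 h2 h3 : R) :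
    Re (A - B + C0 - (RtoC h1 * D - RtoC h2 * E0 + RtoC h3 * F))%C
    = Re A - Re B + Re C0 - (h1 * Re D - h2 * Re E0 + h3 * Re F).
  by case: A B C0 D E0 F => [? ?] [? ?] [? ?] [? ?] [? ?] [? ?]; rewrite /Re /=; ring.
rewrite /eta ReE in E.
have {}E : 2 * det_dw_l (fun v => Im (snd v)) (shear_x s) (shear_y s) e_2 * (/ Im (fst x)) ^ 2
  = deriv (re_at beta (shear_y s) e_2) (shear_x s) x
  - deriv (re_at beta (shear_x s) e_2) (shear_y s) x
  + deriv (re_at beta (shear_x s) (shear_y s)) e_2 x
  - (Im (fst (shear_x s)) / Im (fst x) * re_at beta (shear_y s) e_2 x
     - Im (fst (shear_y s)) / Im (fst x) * re_at beta (shear_x s) e_2 x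
     + Im (fst e_2) / Im (fst x) * re_at beta (shear_x s) (shear_y s) x) := E.
rewrite (coord (shear_y s) e_2) (coord (shear_x s) e_2) (coord (shear_x s) (shear_y s)) in E.
rewrite (form11_coordinates (shear_y s) e_2 b11 x0) (form11_coordinates (shear_x s) e_2 b11 x0)
  (form11_coordinates (shear_x s) (shear_y s) b11 x0) in E.
have y0 : Im (fst x) <> 0 by move: x0; rewrite /HC; lra.
have -> : 2 / Im (fst x) ^ 2 = 2 * 1 * (/ Im (fst x)) ^ 2 by field.
move: E; have -> : det_dw_l (fun v => Im (snd v)) (shear_x s) (shear_y s) e_2 = 1.
  by rewrite /det_dw_l /shear_x /shear_y /e_2 /Ci /Re /Im /=; ring.
move=> ->.
rewrite /=; field; exact: y0.
Qed.

(** * Invariant components of an invariant form *)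

Lemma continuous_re_at (beta : form 2) (X Y : CC -> CC) x :
  smooth_form beta -> form11 beta -> HC x -> continuous X x -> continuous Y x ->
  continuous (fun y => re_at beta (X y) (Y y) y) x.
Proof.
move=> sm b11 x0 cX cY.
have c u v : continuous (re_at beta u v) x by case: (C1_re_at u v sm) => h _; exact: h.
have [d hd] := HC_open x0.
apply: (continuous_ext_loc _ _ _ (ex_intro _ d (fun y hy =>
  esym (form11_coordinates (X y) (Y y) b11 (hd y hy))))).
have := c e_x e_y; have := c e_1 e_2; have := c e_y e_2; have := c e_x e_2.
rewrite /Re /Im => *.
cont.
Qed.

Lemma re_at_invariant G (beta : form 2) A B b c u v x :
  Defs.invariant G beta -> G (affine_map A B b c) -> HC x ->
  re_at beta (affine_tangent A b u) (affine_tangent A b v) (affine_map A B b c x)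
  = re_at beta u v x.
Proof.
move=> inv Gg x0; rewrite /re_at -(inv _ Gg x x0) /pullback; congr (Re (beta _ _)).
rewrite -(@tup_affine A b [:: u; v] 2) //.
by apply: functional_extensionality => i; rewrite tangent_affine.
Qed.

(** Vector fields that are preserved by the affine group. *)
Definition equivariant (X : CC -> CC) : Prop :=
  forall A B b c x, X (affine_map A B b c x) = affine_tangent A b (X x).

(** The value of an invariant form on two invariant vector fields is an
    invariant function. *)
Lemma bounded_re_at alpha a1 a2 b1 b2 c1 c2 r t (beta : form 2) (X Y : CC -> CC) :
  1 < alpha -> a1 * b2 - a2 * b1 <> 0 -> inoue_kappa a1 a2 b1 b2 r <> 0 ->
  real11 (inoue_group alpha a1 a2 b1 b2 c1 c2 r t) beta ->
  equivariant X -> equivariant Y ->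
  (forall x, HC x -> continuous X x) -> (forall x, HC x -> continuous Y x) ->
  exists M, forall x, HC x -> Rabs (re_at beta (X x) (Y x) x) <= M.
Proof.
move=> alpha1 det0 kappa0 [sm [_ [b11 inv]]] eX eY cX cY.
have finv A B b c x : inoue_group alpha a1 a2 b1 b2 c1 c2 r t (affine_map A B b c) ->
    HC x -> re_at beta (X (affine_map A B b c x)) (Y (affine_map A B b c x))
      (affine_map A B b c x) = re_at beta (X x) (Y x) x.
  by move=> Gg x0; rewrite eX eY; exact: re_at_invariant inv Gg x0.
apply: (bounded_of_invariant (f := fun x => re_at beta (X x) (Y x) x) (t := t)
   (c1 := c1) (c2 := c2) alpha1 det0 kappa0).
- by move=> x x0; apply: continuous_re_at => //; [exact: cX | exact: cY].
- move=> x x0; rewrite phi0_affine; apply: finv => //; rewrite -phi0_affine.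
  by apply: generated_gen; tauto.
- move=> x x0; rewrite phi12_affine; apply: finv => //; rewrite -phi12_affine.
  by apply: generated_gen; tauto.
- move=> x x0; rewrite phi12_affine; apply: finv => //; rewrite -phi12_affine.
  by apply: generated_gen; tauto.
- move=> x x0; rewrite phi3_affine; apply: finv => //; rewrite -phi3_affine.
  by apply: generated_gen; tauto.
Qed.

Definition frame1 (x : CC) : CC := ((Im (fst x), 0), (Im (snd x), 0)).
Definition frame2 (x : CC) : CC := ((0, Im (fst x)), (0, Im (snd x))).
Definition frame4 (_ : CC) : CC := e_2.

Lemma equivariant_frame1 : equivariant frame1.
Proof.
move=> A B b c [[? ?] [? ?]]; rewrite /frame1 /affine_map /affine_tangent /Im /=.
by rewrite /Cmult /Cplus /=; congr pair; congr pair; ring.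
Qed.

Lemma equivariant_frame2 : equivariant frame2.
Proof.
move=> A B b c [[? ?] [? ?]]; rewrite /frame2 /affine_map /affine_tangent /Im /=.
by rewrite /Cmult /Cplus /=; congr pair; congr pair; ring.
Qed.

Lemma equivariant_frame4 : equivariant frame4.
Proof.
move=> A B b c [[? ?] [? ?]]; rewrite /frame4 /e_2 /affine_map /affine_tangent /=.
by congr pair; ring.
Qed.

Lemma continuous_frame1 x : continuous frame1 x.
Proof. rewrite /frame1 /Im; cont. Qed.

Lemma continuous_frame2 x : continuous frame2 x.
Proof. rewrite /frame2 /Im; cont. Qed.

(** * The second class does not vanish *)

(** In both parametrizations [z2 / y = s].  Here a change of [s] moves only
    [z2], which suits the derivative of [a].  With [sheared_point] the
    coordinate lines of [x] and [y] have the directions [shear_x s] and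
    [shear_y s], which suits the derivatives of [c] and [d].  The two differ
    by a shift of [t] that depends on [x] and [s] only. *)
Definition fibre_point (kappa t x y s : R) : CC := ((x, y), (kappa * t, s * y)).

Definition sheared_point (kappa t x y s : R) : CC := ((x, y), (kappa * t + s * x, s * y)).

Lemma jointly_continuous_of (U : UniformSpace) (Ou : U -> Prop) (f : R -> R -> U -> R) :
  (forall q : R * (R * U), Ou q.2.2 -> continuous (fun q => f q.1 q.2.1 q.2.2) q) ->
  jointly_continuous Ou f.
Proof. by move=> cf t x u uO; apply: cf. Qed.

Lemma continuous_comp_HC (U : UniformSpace) (f : CC -> R) (g : U -> CC) u :
  (forall x, HC x -> continuous f x) -> HC (g u) -> continuous g u ->
  continuous (fun v => f (g v)) u.
Proof. by move=> cf gu cg; apply: (continuous_comp g f) => //; exact: cf. Qed.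

Lemma deriv_translate (f : CC -> R) kappa v x :
  (forall y, HC y -> f (phi3 kappa y) = f y) -> HC x ->
  deriv f v (phi3 kappa x) = deriv f v x.
Proof.
move=> per x0.
have x0' : HC (line x v 0) by rewrite line0.
apply: Derive_ext_loc; have [d hd] := HC_line x0'; exists d => s /hd hs.
rewrite -(per _ hs); congr f.
by rewrite /phi3 /line /=; congr pair; ring.
Qed.

Lemma is_derive_quadratic (p t q : R -> R) (p' t' q' s : R) :
  is_derive p s p' -> is_derive t s t' -> is_derive q s q' ->
  is_derive (fun s => p s + 2 * s * t s + s * s * q s) s
    (p' + (2 * t s + 2 * s * t') + (2 * s * q s + s * s * q')).
Proof.
move=> dp dt dq; auto_derive.
  by split; [exists p' | split; [exists t' | split; [exists q' |]]].
rewrite (is_derive_unique _ _ _ dp) (is_derive_unique _ _ _ dt) (is_derive_unique _ _ _ dq).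
by ring.
Qed.

Lemma is_derive_height_scaled (t q : R -> R) (t' q' s y : R) :
  is_derive t y t' -> is_derive q y q' ->
  is_derive (fun y => y * (t y + s * q y)) y ((t y + s * q y) + y * (t' + s * q')).
Proof.
move=> dt dq; auto_derive; first by split; [exists t' | split; [exists q' |]].
by rewrite (is_derive_unique _ _ _ dt) (is_derive_unique _ _ _ dq); ring.
Qed.

Ltac cont_point cont0 cont1 := match goal with
  | |- continuous (fun q => deriv ?f ?v (@?g q)) ?u =>
      apply: (@continuous_comp_HC _ (deriv f v) g u);
        [by apply: cont1 | by [] | rewrite /fibre_point /sheared_point ]
  | |- continuous (fun q => ?f (@?g q)) ?u =>
      apply: (@continuous_comp_HC _ f g u); [by apply: cont0 | by [] | rewrite /fibre_point /sheared_point ]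
  end.

(** The bounded functions of the last three hypotheses are the components of
    the form on the invariant frame.  In the variables of [fibre_point] and
    [sheared_point] they satisfy the hypotheses of [no_bounded_flux]. *)
Lemma no_bounded_coordinates (kappa M : R) (P Q S T : CC -> R) : kappa <> 0 ->
  C1_on_HC P -> C1_on_HC Q -> C1_on_HC S -> C1_on_HC T ->
  (forall x, HC x -> P (phi3 kappa x) = P x) ->
  (forall x, HC x -> Q (phi3 kappa x) = Q x) ->
  (forall x, HC x -> T (phi3 kappa x) = T x) ->
  (forall x s, HC x ->
    deriv S (shear_x s) x
    - (deriv T (shear_y s) x + s * deriv Q (shear_y s) x)
    + (deriv P e_2 x + 2 * s * deriv T e_2 x + s ^ 2 * deriv Q e_2 x)
    + (T x + s * Q x) / Im (fst x) = 2 / Im (fst x) ^ 2) ->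
  (forall x, HC x -> Rabs (Im (fst x) ^ 2 * P x + 2 * Im (fst x) * Im (snd x) * T x
     + Im (snd x) ^ 2 * Q x) <= M) ->
  (forall x, HC x -> Rabs (Im (fst x) * S x) <= M) ->
  (forall x, HC x -> Rabs (Im (fst x) * T x + Im (snd x) * Q x) <= M) ->
  False.
Proof.
move=> kappa0 C1P C1Q C1S C1T perP perQ perT eqn bA bC bD.
pose a t x y s := P (fibre_point kappa t x y s) + 2 * s * T (fibre_point kappa t x y s)
  + s * s * Q (fibre_point kappa t x y s).
pose a' t x y s := y * deriv P e_2 (fibre_point kappa t x y s)
  + (2 * T (fibre_point kappa t x y s) + 2 * s * (y * deriv T e_2 (fibre_point kappa t x y s)))
  + (2 * s * Q (fibre_point kappa t x y s)
     + s * s * (y * deriv Q e_2 (fibre_point kappa t x y s))).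
pose c s t x y := y * S (sheared_point kappa t x y s).
pose c' s t x y := y * deriv S (shear_x s) (sheared_point kappa t x y s).
pose d s t x y := y * (T (sheared_point kappa t x y s) + s * Q (sheared_point kappa t x y s)).
pose d' s t x y := (T (sheared_point kappa t x y s) + s * Q (sheared_point kappa t x y s))
  + y * (deriv T (shear_y s) (sheared_point kappa t x y s)
         + s * deriv Q (shear_y s) (sheared_point kappa t x y s)).
have cont0 f : C1_on_HC f -> forall x, HC x -> continuous f x by case.
have cont1 f v : C1_on_HC f -> forall x, HC x -> continuous (deriv f v) x.
  by case=> _ /(_ v)[].
have fibE t x y s : fibre_point kappa (t + s * x / kappa) x y s = sheared_point kappa t x y s.
  by rewrite /fibre_point /sheared_point; congr (_, (_, _)); field.
have Hf t x y s : 0 < y -> HC (fibre_point kappa t x y s) by [].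
have Hs t x y s : 0 < y -> HC (sheared_point kappa t x y s) by [].
apply: (@no_bounded_flux M (fun x s => s * x / kappa) a a' c c' d d').
- by apply: jointly_continuous_of => q q0; rewrite /a; cont; cont_point cont0 cont1; cont.
- by apply: jointly_continuous_of => q q0; rewrite /a'; cont; cont_point cont0 cont1; cont.
- by move=> s; apply: jointly_continuous_of => q q0; rewrite /c; cont; cont_point cont0 cont1; cont.
- by move=> s; apply: jointly_continuous_of => q q0; rewrite /c'; cont; cont_point cont0 cont1; cont.
- by move=> s; apply: jointly_continuous_of => q q0; rewrite /d; cont; cont_point cont0 cont1; cont.
- by move=> s; apply: jointly_continuous_of => q q0; rewrite /d'; cont; cont_point cont0 cont1; cont.
- move=> t x y s y0.
  have der f : C1_on_HC f -> is_derive (fun s => f (fibre_point kappa t x y s)) s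
      (y * deriv f e_2 (fibre_point kappa t x y s)).
    move=> C1f; apply: is_derive_affine_path => // r.
    rewrite /line /fibre_point /e_2 /Ci /RtoC /Cplus /Cmult /=.
    by congr pair; congr pair; ring.
  exact: (is_derive_quadratic (der _ C1P) (der _ C1T) (der _ C1Q)).
- move=> s t x y y0; rewrite /c /c'.
  apply: is_derive_scal; rewrite -[deriv _ _ _]Rmult_1_l.
  apply: (is_derive_affine_path (gam := fun x => sheared_point kappa t x y s)) => // r.
  rewrite /line /sheared_point /shear_x /RtoC /Cplus /Cmult /=.
  by congr pair; congr pair; ring.
- move=> s t x y y0; rewrite /d.
  have der f : C1_on_HC f -> is_derive (fun y => f (sheared_point kappa t x y s)) y
      (deriv f (shear_y s) (sheared_point kappa t x y s)).
    move=> C1f; rewrite -[deriv _ _ _]Rmult_1_l; apply: (is_derive_affine_path (gam := fun y => sheared_point kappa t x y s)) => // r.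
    rewrite /line /sheared_point /shear_y /Ci /RtoC /Cplus /Cmult /=.
    by congr pair; congr pair; ring.
  exact: (is_derive_height_scaled s (der _ C1T) (der _ C1Q)).
- move=> t x y s y0.
  have E : fibre_point kappa (t + 1) x y s = phi3 kappa (fibre_point kappa t x y s).
    by rewrite /fibre_point /phi3 /RtoC /Cplus /=; congr pair; congr pair; ring.
  by rewrite /a' E perQ ?perT ?deriv_translate //; exact: Hf.
- move=> t x y s y0; rewrite /a' /c' /d' fibE.
  have := eqn _ s (Hs t x y s y0); set p := sheared_point _ _ _ _ _.
  have -> : Im (fst p) = y by [].
  move=> E.
  have -> : 2 / y = y * (2 / y ^ 2) by field; lra.
  by rewrite -E; field; lra.
- move=> t x y s y1; have y0 : 0 < y by lra.
  have := bA _ (Hf t x y s y0); set p := fibre_point _ _ _ _ _.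
  have -> : Im (fst p) = y by []. have -> : Im (snd p) = s * y by [].
  have -> : y ^ 2 * P p + 2 * y * (s * y) * T p + (s * y) ^ 2 * Q p = y ^ 2 * a t x y s.
    by rewrite /a -/p; ring.
  rewrite Rabs_mult (Rabs_pos_eq (y ^ 2)); last exact: pow2_ge_0.
  have y2 : 1 <= y ^ 2 by rewrite /=; nra.
  have := Rmult_le_compat_r _ _ _ (Rabs_pos (a t x y s)) y2; lra.
- move=> s t x y y1; exact: (bC _ (Hs t x y s (Rlt_le_trans _ _ _ Rlt_0_1 y1))).
- move=> s t x y y1; have y0 : 0 < y by lra.
  have := bD _ (Hs t x y s y0); set p := sheared_point _ _ _ _ _.
  have -> : Im (fst p) = y by []. have -> : Im (snd p) = s * y by [].
  by rewrite /d -/p; have -> : y * T p + s * y * Q p = y * (T p + s * Q p) by ring.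
Qed.

Lemma dz2_not_coboundary alpha a1 a2 b1 b2 c1 c2 r t :
  1 < alpha -> a1 * b2 - a2 * b1 <> 0 -> inoue_kappa a1 a2 b1 b2 r <> 0 ->
  ~ coboundary (inoue_group alpha a1 a2 b1 b2 c1 c2 r t) (i_theta1_theta1bar_wedge dz2).
Proof.
move=> alpha1 det0 kappa0 [beta [real11_beta eqb]].
have [sm [_ [b11 inv]]] := real11_beta.
set kappa := inoue_kappa a1 a2 b1 b2 r in kappa0.
pose P := re_at beta e_x e_y; pose Q := re_at beta e_1 e_2.
pose S := re_at beta e_y e_2; pose T := re_at beta e_x e_2.
have C1P : C1_on_HC P := C1_re_at e_x e_y sm.
have C1Q : C1_on_HC Q := C1_re_at e_1 e_2 sm.
have C1S : C1_on_HC S := C1_re_at e_y e_2 sm.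
have C1T : C1_on_HC T := C1_re_at e_x e_2 sm.
have bnd X Y := bounded_re_at (X := X) (Y := Y) alpha1 det0 kappa0 real11_beta.
have cf1 x : HC x -> continuous frame1 x by move=> _; exact: continuous_frame1.
have cf2 x : HC x -> continuous frame2 x by move=> _; exact: continuous_frame2.
have cf4 x : HC x -> continuous frame4 x by move=> _; exact: continuous_const.
have [M1 hM1] := bnd _ _ equivariant_frame1 equivariant_frame2 cf1 cf2.
have [M2 hM2] := bnd _ _ equivariant_frame2 equivariant_frame4 cf2 cf4.
have [M3 hM3] := bnd _ _ equivariant_frame1 equivariant_frame4 cf1 cf4.
have v12 x : HC x -> re_at beta (frame1 x) (frame2 x) x
    = Im (fst x) ^ 2 * P x + 2 * Im (fst x) * Im (snd x) * T x + Im (snd x) ^ 2 * Q x.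
  move=> x0; rewrite (form11_coordinates _ _ b11 x0) /frame1 /frame2.
  by rewrite -/P -/Q -/S -/T /Re /Im /=; ring.
have v24 x : HC x -> re_at beta (frame2 x) (frame4 x) x = Im (fst x) * S x.
  move=> x0; rewrite (form11_coordinates _ _ b11 x0) /frame2 /frame4.
  by rewrite -/P -/Q -/S -/T /Re /Im /e_2 /=; ring.
have v14 x : HC x -> re_at beta (frame1 x) (frame4 x) x
    = Im (fst x) * T x + Im (snd x) * Q x.
  move=> x0; rewrite (form11_coordinates _ _ b11 x0) /frame1 /frame4.
  by rewrite -/P -/Q -/S -/T /Re /Im /e_2 /=; ring.
have per u v x : HC x -> re_at beta u v (phi3 kappa x) = re_at beta u v x.
  move=> x0; have tang w : affine_tangent 1 0 w = w.
    by case: w => w z; rewrite /affine_tangent /=; congr pair; ring.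
  have Gphi3 : inoue_group alpha a1 a2 b1 b2 c1 c2 r t (affine_map 1 0 0 kappa).
    by rewrite -phi3_affine; apply: generated_gen; tauto.
  by have := re_at_invariant u v inv Gphi3 x0; rewrite !tang -phi3_affine.
set M := Rmax M1 (Rmax M2 M3).
have M1M : M1 <= M by exact: Rmax_l.
have M2M : M2 <= M by apply: Rle_trans (Rmax_l M2 M3) (Rmax_r _ _).
have M3M : M3 <= M by apply: Rle_trans (Rmax_r M2 M3) (Rmax_r _ _).
apply: (@no_bounded_coordinates kappa M P Q S T) => //.
- by move=> x; exact: per.
- by move=> x; exact: per.
- by move=> x; exact: per.
- by move=> x s x0; exact: primitive_of_dz2_equation.
- by move=> x x0; rewrite -v12 //; apply: Rle_trans (hM1 x x0) _.
- by move=> x x0; rewrite -v24 //; apply: Rle_trans (hM2 x x0) _.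
- by move=> x x0; rewrite -v14 //; apply: Rle_trans (hM3 x x0) _.
Qed.

Theorem proposition7p2
  (n11 n12 n21 n22 p q r : Z) (alpha a1 a2 b1 b2 c1 c2 t : R)
  (hN : (n11 * n22 - n12 * n21 = 1)%Z)
  (halpha : (1 < alpha)%R)
  (ha : (a1, a2) <> (0, 0)%R)
  (ha1 : (IZR n11 * a1 + IZR n12 * a2 = alpha * a1)%R)
  (ha2 : (IZR n21 * a1 + IZR n22 * a2 = alpha * a2)%R)
  (hb : (b1, b2) <> (0, 0)%R)
  (hb1 : (IZR n11 * b1 + IZR n12 * b2 = / alpha * b1)%R)
  (hb2 : (IZR n21 * b1 + IZR n22 * b2 = / alpha * b2)%R)
  (hr : r <> 0%Z)
  (hc1 : (c1 = c1 * IZR n11 + c2 * IZR n12 + inoue_e a1 a2 b1 b2 n11 n12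
               + inoue_kappa a1 a2 b1 b2 r * IZR p)%R)
  (hc2 : (c2 = c1 * IZR n21 + c2 * IZR n22 + inoue_e a1 a2 b1 b2 n21 n22
               + inoue_kappa a1 a2 b1 b2 r * IZR q)%R) :
  class_vanishes (inoue_group alpha a1 a2 b1 b2 c1 c2 r t)
    (i_theta1_theta1bar_wedge dz1) /\
  class_nonzero (inoue_group alpha a1 a2 b1 b2 c1 c2 r t)
    (i_theta1_theta1bar_wedge dz2).
Proof.
have Gaff g : inoue_group alpha a1 a2 b1 b2 c1 c2 r t g ->
    exists A B b c, 0 < A /\ g = affine_map A B b c by exact: inoue_group_affine.
have lt1 : / alpha < 1 by rewrite -Rinv_1; apply: Rinv_lt_contravar; lra.
have det0 : a1 * b2 - a2 * b1 <> 0.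
  by apply: (eigenvectors_independent _ ha hb ha1 ha2 hb1 hb2); lra.
have kappa0 : inoue_kappa a1 a2 b1 b2 r <> 0.
  rewrite /inoue_kappa /Rdiv; apply: Rmult_integral_contrapositive_currified; first lra.
  by apply: Rinv_neq_0_compat; apply: not_0_IZR.
split; split.
- exact: cocycle_dz1.
- by exists primitive_dz1; split; [exact: real11_primitive | exact: d_eta_primitive].
- exact: cocycle_dz2.
- exact: dz2_not_coboundary.
Qed.
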